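(* Let $q,f$ satisfy the standing assumptions, let $\alpha\in(0,\pi)$ and $c\in\mathbb R$. Let $\phi\in C^2(\mathbb R^2)$ be a bounded solution of $\Delta\phi+(q(x)-c)\partial_y\phi+f(\phi)=0$ in $\mathbb R^2$ satisfying $$\lim_{l\to-\infty}\Big(\sup_{(x,y)\in C^-_{\alpha,l}}\phi(x,y)\Big)=0,\qquad \lim_{l\to+\infty}\Big(\inf_{(x,y)\in C^+_{\alpha,l}}\phi(x,y)\Big)=1.$$ Then $\phi$ is strictly increasing in $y$: $\phi(x,y+h)>\phi(x,y)$ for all $(x,y)\in\mathbb R^2$ and all $h>0$.
   Context: Standing assumptions: $q\in C^{1,\delta}(\mathbb R)$ for some $\delta>0$, $q(x+L)=q(x)$ for all $x$ and $\int_0^L q(x)\,dx=0$ for some $L>0$. The function $f:[0,1]\to\mathbb R$ is Lipschitz continuous, continuously differentiable on $(1-r,1]$ for some $r>0$, and there is $\theta\in(0,1)$ with $f\equiv0$ on $[0,\theta]\cup\{1\}$, $f>0$ on $(\theta,1)$ and $f'(1)<0$; $f$ is extended by $0$ outside $[0,1]$. Cones: for $\alpha\in(0,\pi)$ and $l\in\mathbb R$, $C^-_{\alpha,l}=\{(x,y)\in\mathbb R^2: y\le x\cot\alpha+l \text{ if } x\le0,\ y\le -x\cot\alpha+l\text{ if }x\ge0\}$ and $C^+_{\alpha,l}=\overline{\mathbb R^2\setminus C^-_{\alpha,l}}$. *)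

(* Defs.v *)
From Stdlib Require Import Reals Lra.
Open Scope R_scope.

Definition C1_holder (q : R -> R) (delta : R) : Prop :=
  exists q' : R -> R,
    (forall x, derivable_pt_lim q x (q' x)) /\
    exists K, forall x y, x <> y -> Rabs (q' x - q' y) <= K * Rpower (Rabs (x - y)) delta.

Definition q_assumptions (q : R -> R) : Prop :=
  (exists delta, 0 < delta /\ C1_holder q delta) /\
  exists L, 0 < L /\ (forall x, q (x + L) = q x) /\
    exists pr : Riemann_integrable q 0 L, RiemannInt pr = 0.

(* standing assumptions on f (f : [0,1] -> R extended by 0 outside [0,1]) *)
Definition f_assumptions (f : R -> R) : Prop :=
  (forall u, (u < 0 \/ 1 < u) -> f u = 0) /\
  (exists K, forall a b, 0 <= a <= 1 -> 0 <= b <= 1 -> Rabs (f a - f b) <= K * Rabs (a - b)) /\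
  (exists r, 0 < r /\ exists f' : R -> R,
     (forall u, 1 - r < u < 1 -> derivable_pt_lim f u (f' u)) /\
     (forall eps, 0 < eps -> exists d, 0 < d /\ forall h, -d < h < 0 ->
        Rabs ((f (1 + h) - f 1) / h - f' 1) < eps) /\
     (forall u, 1 - r < u <= 1 -> forall eps, 0 < eps -> exists d, 0 < d /\
        forall v, 1 - r < v <= 1 -> Rabs (v - u) < d -> Rabs (f' v - f' u) < eps) /\
     f' 1 < 0) /\
  (exists theta, 0 < theta < 1 /\
     (forall u, 0 <= u <= theta -> f u = 0) /\ f 1 = 0 /\
     (forall u, theta < u < 1 -> 0 < f u)).

Definition cont2 (g : R -> R -> R) : Prop :=
  forall x y eps, 0 < eps -> exists d, 0 < d /\
    forall x' y', Rabs (x' - x) < d -> Rabs (y' - y) < d -> Rabs (g x' y' - g x y) < eps.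

Definition C2_with (phi phix phiy phixx phixy phiyx phiyy : R -> R -> R) : Prop :=
  cont2 phi /\ cont2 phix /\ cont2 phiy /\
  cont2 phixx /\ cont2 phixy /\ cont2 phiyx /\ cont2 phiyy /\
  (forall x y, derivable_pt_lim (fun s => phi s y) x (phix x y)) /\
  (forall x y, derivable_pt_lim (fun t => phi x t) y (phiy x y)) /\
  (forall x y, derivable_pt_lim (fun s => phix s y) x (phixx x y)) /\
  (forall x y, derivable_pt_lim (fun t => phix x t) y (phixy x y)) /\
  (forall x y, derivable_pt_lim (fun s => phiy s y) x (phiyx x y)) /\
  (forall x y, derivable_pt_lim (fun t => phiy x t) y (phiyy x y)).

Definition cot (a : R) : R := cos a / sin a.

Definition cone_minus (alpha l : R) (x y : R) : Prop :=
  (x <= 0 -> y <= x * cot alpha + l) /\ (0 <= x -> y <= - x * cot alpha + l).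

Definition closure2 (S : R -> R -> Prop) (x y : R) : Prop :=
  forall eps, 0 < eps -> exists x' y', S x' y' /\
    sqrt ((x' - x) ^ 2 + (y' - y) ^ 2) < eps.

Definition cone_plus (alpha l : R) (x y : R) : Prop :=
  closure2 (fun x' y' => ~ cone_minus alpha l x' y') x y.

Definition is_glb (E : R -> Prop) (m : R) : Prop :=
  (forall z, E z -> m <= z) /\ (forall b, (forall z, E z -> b <= z) -> b <= m).

Definition values_on (phi : R -> R -> R) (S : R -> R -> Prop) (z : R) : Prop :=
  exists x y, S x y /\ z = phi x y.

(* Main.v *)
Require Import Defs.
From Stdlib Require Import Reals ZArith Lra Lia Classical.
From Coquelicot Require Import Coquelicot.
Open Scope R_scope.

(* Sliding method.  With L = Delta + (q - c) d_y and w = phi(x, y + h) - phi(x, y), one shows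
   w >= 0 for large h and then decreases h to 0.  Three estimates replace the usual
   compactness of translates:
   - Doubling the variable: v(x, y, t) = phi(x, y + t) - phi(x, y - t) solves a linear equation
     that is elliptic in (x, t), so a barrier vanishing at t = 0 bounds it.  On a box of size
     R x R^2 this yields |v| = O(t / R) as soon as |f(phi)| <= 1 / R^2.  Taking R = 1 shows that
     phi is Lipschitz; letting R grow with the distance to the cone boundary shows that w tends
     to 0 on both sides of it.
   - Comparison: if Lw <= 0 wherever w < 0, then w >= 0.  A negative infimum could only be
     approached in a strip of bounded width around the cone boundary, where exp(-a sigma) is a
     strict barrier.  The condition holds where both values are below theta (f = 0) and where
     both are close to or above 1 (f is nonincreasing).
   - If w >= 0, then w has a positive lower bound on each strip: along a vertical line the
     increments of phi telescope to almost 1, so one of boundedly many is not small, and Hopf's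
     barrier carries this lower bound back to the given point. *)

(** * Minimum tests and compactness of boxes *)

(** Every use touches a solution with a barrier along one axis, so the two functions are kept apart.
    For the second-order part: if [g2 < v2], the derivative of [g - v] vanishes at [a] and is
    negative just to the right of it, and the mean value theorem contradicts minimality. *)
Lemma local_min_test (g v g1 v1 : R -> R) (g2 v2 a d : R) :
  0 < d ->
  (forall x, Rabs (x - a) < d -> g a - v a <= g x - v x) ->
  (forall x, is_derive g x (g1 x)) -> (forall x, is_derive v x (v1 x)) ->
  is_derive g1 a g2 -> is_derive v1 a v2 ->
  g1 a = v1 a /\ v2 <= g2.
Proof.
intros Hd Hmin Hg Hv Hg2 Hv2.
assert (Hf : forall x, is_derive (fun x => g x - v x) x (g1 x - v1 x)).
{ intros x. apply (is_derive_minus g v x _ _ (Hg x) (Hv x)). }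
assert (Hf2 : is_derive (fun x => g1 x - v1 x) a (g2 - v2)).
{ apply (is_derive_minus g1 v1 a _ _ Hg2 Hv2). }
assert (Hcrit : g1 a - v1 a = 0).
{ set (pr := fun x => exist _ (g1 x - v1 x) (proj1 (is_derive_Reals _ _ _) (Hf x)) : derivable_pt (fun x => g x - v x) x).
  change (derive_pt (fun x => g x - v x) a (pr a) = 0).
  apply deriv_minimum with (a - d) (a + d); try lra.
  intros x H1 H2. apply Hmin. apply Rabs_def1; lra. }
split; [lra|].
destruct (Rle_lt_dec v2 g2) as [H|H]; [exact H|exfalso].
apply is_derive_Reals in Hf2.
destruct (Hf2 ((v2 - g2) / 2)) as [del Hdel]; [lra|].
set (e := Rmin (del / 2) (d / 2)).
assert (He : 0 < e /\ e < del /\ e < d).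
{ pose proof (cond_pos del). unfold e. split; [apply Rmin_glb_lt; lra|].
  pose proof (Rmin_l (del / 2) (d / 2)); pose proof (Rmin_r (del / 2) (d / 2)). lra. }
destruct (MVT_cor2 (fun x => g x - v x) (fun x => g1 x - v1 x) a (a + e)) as [xi [Heq Hxi]].
{ lra. }
{ intros x _. apply is_derive_Reals, Hf. }
pose proof (Hmin (a + e)) as Hm.
rewrite Rabs_pos_eq in Hm by lra.
assert (Hpos : 0 <= g1 xi - v1 xi).
{ apply Rmult_le_reg_r with e; [lra|]. replace (a + e - a) with e in * by ring. lra. }
specialize (Hdel (xi - a) ltac:(lra)).
rewrite Rabs_pos_eq in Hdel by lra. specialize (Hdel ltac:(lra)).
replace (a + (xi - a)) with xi in Hdel by ring.
apply Rabs_def2 in Hdel. destruct Hdel as [Hd1 _].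
rewrite Hcrit in Hd1.
assert (0 <= (g1 xi - v1 xi - 0) / (xi - a)) by (apply Rdiv_le_0_compat; lra). lra.
Qed.

(** The cluster point is the lower limit of the decreasing sets [P n]: the supremum of the [c] that
    eventually bound them from below. If [P n] missed a neighbourhood of radius [d], some later set
    would lie above [x0 + d], and [x0 + d] would itself be such a [c]. *)
Lemma interval_cluster (a b : R) (P : nat -> R -> Prop) :
  a <= b ->
  (forall n m x, (n <= m)%nat -> P m x -> P n x) ->
  (forall n, exists x, a <= x <= b /\ P n x) ->
  exists x0, a <= x0 <= b /\
    forall n d, 0 < d -> exists x, a <= x <= b /\ Rabs (x - x0) < d /\ P n x.
Proof.
intros Hab Hdec Hex.
set (E := fun c => a <= c <= b /\ exists n, forall x, a <= x <= b -> P n x -> c <= x).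
destruct (completeness E) as [x0 [Hub Hlub]].
{ exists b. intros c [Hc _]. lra. }
{ exists a. split; [lra|]. exists O. intros; lra. }
assert (Hx0 : a <= x0 <= b).
{ split; [apply Hub; split; [lra|exists O; intros; lra]|].
  apply Hlub. intros c [Hc _]. lra. }
exists x0. split; [exact Hx0|].
intros n d Hd. apply NNPP. intros Hn.
assert (Hc : exists c, E c /\ x0 - d < c).
{ apply NNPP. intros Hno.
  assert (x0 <= x0 - d); [|lra].
  apply Hlub. intros c Hc. apply Rnot_lt_le. intros Hlt. apply Hno. exists c; auto. }
destruct Hc as [c [[Hcab [m Hm]] Hcd]].
assert (Hfar : forall x, a <= x <= b -> P (max n m) x -> x0 + d <= x).
{ intros x Hx HP. apply Rnot_lt_le. intros Hlt. apply Hn. exists x.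
  assert (c <= x) by (apply Hm; [exact Hx|apply Hdec with (max n m); [lia|exact HP]]).
  split; [exact Hx|split; [apply Rabs_def1; lra|]].
  apply Hdec with (max n m); [lia|exact HP]. }
destruct (Hex (max n m)) as [x [Hx HP]].
specialize (Hfar x Hx HP) as Hfx.
assert (E (x0 + d)) as HE by (split; [lra|exists (max n m); exact Hfar]).
apply Hub in HE. lra.
Qed.

(** One coordinate at a time. The condition of being within [/ (INR n + 1)] of the coordinates
    already found is put into the predicate, which keeps it decreasing in [n]. *)
Lemma box_cluster (a1 b1 a2 b2 a3 b3 : R) (P : nat -> R -> R -> R -> Prop) :
  a1 <= b1 -> a2 <= b2 -> a3 <= b3 ->
  (forall n m x y t, (n <= m)%nat -> P m x y t -> P n x y t) ->
  (forall n, exists x y t, a1 <= x <= b1 /\ a2 <= y <= b2 /\ a3 <= t <= b3 /\ P n x y t) ->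
  exists x0 y0 t0, a1 <= x0 <= b1 /\ a2 <= y0 <= b2 /\ a3 <= t0 <= b3 /\
    forall n d, 0 < d -> exists x y t, a1 <= x <= b1 /\ a2 <= y <= b2 /\ a3 <= t <= b3 /\
      Rabs (x - x0) < d /\ Rabs (y - y0) < d /\ Rabs (t - t0) < d /\ P n x y t.
Proof.
intros H1 H2 H3 Hdec Hex.
assert (Hinv : forall n m, (n <= m)%nat -> / (INR m + 1) <= / (INR n + 1)).
{ intros n m Hnm. apply Rinv_le_contravar; [pose proof (pos_INR n); lra|].
  apply le_INR in Hnm. lra. }
assert (Hsmall : forall n d, 0 < d -> exists m, (n <= m)%nat /\ / (INR m + 1) < d).
{ intros n d Hd. destruct (archimed_cor1 d Hd) as [N [HN HN0]].
  exists (max n N). split; [lia|]. apply Rle_lt_trans with (/ INR N); [|exact HN].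
  apply Rinv_le_contravar; [apply lt_0_INR; lia|].
  pose proof (le_INR N (max n N) ltac:(lia)). lra. }
assert (Hpos : forall n, 0 < / (INR n + 1)).
{ intros n. apply Rinv_0_lt_compat. pose proof (pos_INR n); lra. }
destruct (interval_cluster a1 b1
  (fun n x => exists y t, a2 <= y <= b2 /\ a3 <= t <= b3 /\ P n x y t)) as [x0 [Hx0 Hc1]]; auto.
{ intros n m x Hnm (y & t & Hy & Ht & HP). exists y, t. repeat split; try tauto. eapply Hdec; eauto. }
{ intros n. destruct (Hex n) as (x & y & t & HH). exists x. split; [tauto|]. exists y, t; tauto. }
destruct (interval_cluster a2 b2
  (fun n y => exists x t, a1 <= x <= b1 /\ a3 <= t <= b3 /\
     Rabs (x - x0) < / (INR n + 1) /\ P n x y t)) as [y0 [Hy0 Hc2]]; auto.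
{ intros n m y Hnm (x & t & Hx & Ht & Hd & HP). exists x, t.
  specialize (Hinv n m Hnm). repeat split; try tauto; [lra|]. eapply Hdec; eauto. }
{ intros n. destruct (Hc1 n _ (Hpos n)) as (x & Hx & Hd & y & t & Hy & Ht & HP).
  exists y; split; [exact Hy|]. exists x, t; auto. }
destruct (interval_cluster a3 b3
  (fun n t => exists x y, a1 <= x <= b1 /\ a2 <= y <= b2 /\
     Rabs (x - x0) < / (INR n + 1) /\ Rabs (y - y0) < / (INR n + 1) /\ P n x y t))
  as [t0 [Ht0 Hc3]]; auto.
{ intros n m t Hnm (x & y & Hx & Hy & Hd & Hd' & HP). exists x, y.
  specialize (Hinv n m Hnm). repeat split; try tauto; try lra. eapply Hdec; eauto. }
{ intros n. destruct (Hc2 n _ (Hpos n)) as (y & Hy & Hd' & x & t & Hx & Ht & Hd & HP).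
  exists t; split; [exact Ht|]. exists x, y; auto. }
exists x0, y0, t0. split; [exact Hx0|split; [exact Hy0|split; [exact Ht0|]]].
intros n d Hd. destruct (Hsmall n d Hd) as [m [Hnm Hm]].
destruct (Hc3 m d Hd) as (t & Ht & Hdt & x & y & Hx & Hy & Hdx & Hdy & HP).
exists x, y, t. repeat split; try tauto; try lra. eapply Hdec; eauto.
Qed.

Lemma box_min (a1 b1 a2 b2 a3 b3 : R) (g : R -> R -> R -> R) :
  a1 <= b1 -> a2 <= b2 -> a3 <= b3 ->
  (forall p : R * R * R, continuous (fun p => g (fst (fst p)) (snd (fst p)) (snd p)) p) ->
  exists x0 y0 t0, a1 <= x0 <= b1 /\ a2 <= y0 <= b2 /\ a3 <= t0 <= b3 /\
    forall x y t, a1 <= x <= b1 -> a2 <= y <= b2 -> a3 <= t <= b3 -> g x0 y0 t0 <= g x y t.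
Proof.
intros H1 H2 H3 Hcont.
assert (Hc : forall x y t eps, 0 < eps -> exists d, 0 < d /\ forall x' y' t',
  Rabs (x' - x) < d -> Rabs (y' - y) < d -> Rabs (t' - t) < d ->
  Rabs (g x' y' t' - g x y t) < eps).
{ intros x y t eps Heps.
  destruct (proj1 (filterlim_locally _ _) (Hcont (x, y, t)) (mkposreal eps Heps)) as [d Hd].
  exists d. split; [apply cond_pos|]. intros x' y' t' Hx Hy Ht.
  apply (Hd (x', y', t')). split; [split|]; assumption. }
(* Values are negated because [completeness] yields suprema; [- s] will be the infimum of [g].
   Clustering is used twice: on points where [g < - INR n], to bound [g] from below, then on almost
   minimizing points. *)
set (V := fun z => exists x y t, a1 <= x <= b1 /\ a2 <= y <= b2 /\ a3 <= t <= b3 /\ z = - g x y t).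
assert (HV : bound V).
{ apply NNPP. intros Hnb.
  destruct (box_cluster a1 b1 a2 b2 a3 b3 (fun n x y t => g x y t < - INR n))
    as (x0 & y0 & t0 & Hx0 & Hy0 & Ht0 & Hcl); auto.
  { intros n m x y t Hnm Hg. apply le_INR in Hnm. lra. }
  { intros n. apply NNPP. intros Hno. apply Hnb. exists (INR n).
    intros z (x & y & t & Hx & Hy & Ht & ->). apply Rnot_lt_le. intros Hlt.
    apply Hno. exists x, y, t. repeat split; try tauto. lra. }
  destruct (Hc x0 y0 t0 1 Rlt_0_1) as [d [Hd Hcd]].
  destruct (INR_unbounded (1 - g x0 y0 t0)) as [n Hn].
  destruct (Hcl n d Hd) as (x & y & t & _ & _ & _ & Hdx & Hdy & Hdt & HP).
  specialize (Hcd x y t Hdx Hdy Hdt). apply Rabs_def2 in Hcd. lra. }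
destruct (completeness V HV) as [s [Hub Hlub]].
{ exists (- g a1 a2 a3), a1, a2, a3. repeat split; lra. }
destruct (box_cluster a1 b1 a2 b2 a3 b3 (fun n x y t => g x y t < - s + / (INR n + 1)))
  as (x0 & y0 & t0 & Hx0 & Hy0 & Ht0 & Hcl); auto.
{ intros n m x y t Hnm Hg.
  assert (/ (INR m + 1) <= / (INR n + 1)); [|lra].
  apply Rinv_le_contravar; [pose proof (pos_INR n); lra|]. apply le_INR in Hnm. lra. }
{ intros n. apply NNPP. intros Hno.
  assert (0 < / (INR n + 1)) by (apply Rinv_0_lt_compat; pose proof (pos_INR n); lra).
  assert (s <= s - / (INR n + 1)); [|lra].
  apply Hlub. intros z (x & y & t & Hx & Hy & Ht & ->). apply Rnot_lt_le. intros Hlt.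
  apply Hno. exists x, y, t. repeat split; try tauto. lra. }
exists x0, y0, t0. split; [exact Hx0|split; [exact Hy0|split; [exact Ht0|]]].
intros x y t Hx Hy Ht. apply Rle_trans with (- s).
2:{ assert (- g x y t <= s); [|lra]. apply Hub. exists x, y, t; auto. }
apply Rnot_lt_le. intros Hlt.
set (e := (g x0 y0 t0 + s) / 2).
assert (He : 0 < e) by (unfold e; lra).
destruct (Hc x0 y0 t0 e He) as [d [Hd Hcd]].
destruct (archimed_cor1 e He) as [n [Hn Hn0]].
destruct (Hcl n d Hd) as (x' & y' & t' & _ & _ & _ & Hdx & Hdy & Hdt & HP).
specialize (Hcd x' y' t' Hdx Hdy Hdt). apply Rabs_def2 in Hcd.
assert (/ (INR n + 1) < / INR n).
{ apply Rinv_lt_contravar; [|lra]. apply lt_0_INR in Hn0. nra. }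
unfold e in *. lra.
Qed.

(** * Symmetric differences of a function with bounded operator *)

(** Tailored to minimum arguments: joint continuity of [u] produces a minimum on a box, and the pure
    derivatives are what a test along each axis reads there. *)
Definition axis_C2 (u ux uy uxx uyy : R -> R -> R) : Prop :=
  (forall p : R * R, continuous (fun p => u (fst p) (snd p)) p) /\
  (forall x y, is_derive (fun s => u s y) x (ux x y)) /\
  (forall x y, is_derive (fun t => u x t) y (uy x y)) /\
  (forall x y, is_derive (fun s => ux s y) x (uxx x y)) /\
  (forall x y, is_derive (fun t => uy x t) y (uyy x y)).

Lemma continuous_uncurry {U : UniformSpace} (u : R -> R -> R) (f g : U -> R) (p : U) :
  (forall p : R * R, continuous (fun p => u (fst p) (snd p)) p) ->
  continuous f p -> continuous g p -> continuous (fun p => u (f p) (g p)) p.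
Proof.
intros Hu Hf Hg. apply (continuous_comp_2 f g u p Hf Hg), Hu.
Qed.

Ltac prove_continuous :=
  repeat match goal with
  | |- continuous (fun _ => ?c) _ => apply continuous_const
  | |- continuous (fun p => fst (fst p)) _ => apply (continuous_comp fst fst); [apply continuous_fst|apply continuous_fst]
  | |- continuous (fun p => snd (fst p)) _ => apply (continuous_comp fst snd); [apply continuous_fst|apply continuous_snd]
  | |- continuous fst _ => apply continuous_fst
  | |- continuous snd _ => apply continuous_snd
  | |- continuous (fun p => fst p) _ => apply continuous_fst
  | |- continuous (fun p => snd p) _ => apply continuous_snd
  | |- continuous (fun p => @?f p + @?g p) ?q => apply (continuous_plus f g q)
  | |- continuous (fun p => @?f p - @?g p) ?q => apply (continuous_minus f g q)
  | |- continuous (fun p => - @?f p) ?q => apply (continuous_opp f q)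
  | |- continuous (fun p => @?f p * @?g p) ?q => apply (continuous_mult f g q)
  | |- continuous (fun p => exp (@?f p)) ?q =>
      apply (continuous_comp f exp q); [|apply (ex_derive_continuous exp); eexists; apply is_derive_exp]
  end.

Lemma is_derive_shift (h : R -> R) (y s l : R) :
  is_derive h (y + s) l -> is_derive (fun y => h (y + s)) y l.
Proof.
intros Hh. evar_last.
- apply (is_derive_comp h (fun y => y + s) y l 1 Hh). auto_derive; auto.
- change (1 * l = l). ring.
Qed.

Lemma is_derive_reflect (h : R -> R) (y s l : R) :
  is_derive h (y - s) l -> is_derive (fun s => h (y - s)) s (- l).
Proof.
intros Hh. evar_last.
- apply (is_derive_comp h (fun s => y - s) s l (-1) Hh). auto_derive; auto.
- change (-1 * l = - l). ring.
Qed.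

(* [v x y t = u x (y + t) - u x (y - t)] satisfies
   [v_xx + v_tt + b v_y = Lu (x, y + t) - Lu (x, y - t)] and vanishes at [t = 0],
   so it is dominated by a barrier [S] that is linear in [t] near [0]. *)
Lemma sym_diff_bound (u ux uy uxx uyy : R -> R -> R) (b : R -> R) (M B g R0 x0 y0 t : R) :
  axis_C2 u ux uy uxx uyy ->
  0 < R0 ->
  (forall x y, Rabs (u x y) <= M) ->
  (forall x, Rabs (b x) <= B) ->
  (forall x y, Rabs (x - x0) <= R0 -> Rabs (y - y0) <= R0 * R0 + R0 ->
    Rabs (uxx x y + uyy x y + b x * uy x y) <= g) ->
  0 <= t <= R0 ->
  u x0 (y0 + t) - u x0 (y0 - t) <=
    (4 * M + 4 * M * B + g * (R0 * R0) + 1) * (2 * (t * / R0)).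
Proof.
intros Hu HR HM HB Hg Ht.
(* Chosen so that [2 * A / R0^2], the concavity of the barrier in [t], strictly exceeds its second
   [x]-derivative, the drift term and [2 * g] together. *)
set (A := 4 * M + 4 * M * B + g * (R0 * R0) + 1).
(* The scale is [R0] in [x] and [t] but [R0^2] in [y]: the drift then contributes at the order
   [1 / R0^2] of the second derivatives. *)
set (S := fun x y t =>
  A * (2 * (t * / R0) - (t * / R0) * (t * / R0)) +
  2 * M * (((x - x0) * / R0) * ((x - x0) * / R0)) +
  2 * M * (((y - y0) * / (R0 * R0)) * ((y - y0) * / (R0 * R0)))).
destruct Hu as (Hc & Hx & Hy & Hxx & Hyy).
assert (HM0 : 0 <= M) by (eapply Rle_trans; [apply Rabs_pos|apply (HM 0 0)]).
assert (HB0 : 0 <= B) by (eapply Rle_trans; [apply Rabs_pos|apply (HB 0)]).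
assert (Hg0 : 0 <= g).
{ eapply Rle_trans; [apply Rabs_pos|apply (Hg x0 y0)]; replace (_ - _) with 0 by ring;
    rewrite Rabs_R0; nra. }
assert (HMB : 0 <= M * B) by nra.
assert (HgR : 0 <= g * (R0 * R0)) by (apply Rmult_le_pos; nra).
assert (HA : 2 * M < A /\ 0 < A) by (unfold A; lra).
assert (HiR : 0 < / R0) by (apply Rinv_0_lt_compat; lra).
assert (Hi1 : R0 * / R0 = 1) by (field; lra).
assert (HR2 : 0 < R0 * R0) by nra.
assert (HiR2 : 0 < / (R0 * R0)) by (apply Rinv_0_lt_compat; lra).
assert (Hi2 : R0 * R0 * / (R0 * R0) = 1) by (field; lra).
apply Rnot_lt_le. intros Hlt.
destruct (box_min (x0 - R0) (x0 + R0) (y0 - R0 * R0) (y0 + R0 * R0) 0 R0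
  (fun x y t => S x y t - (u x (y + t) - u x (y - t))))
  as (x1 & y1 & t1 & Hx1 & Hy1 & Ht1 & Hmin); try lra.
{ intros p. unfold S. prove_continuous; apply continuous_uncurry; auto; prove_continuous. }
assert (Hneg : S x1 y1 t1 - (u x1 (y1 + t1) - u x1 (y1 - t1)) < 0).
{ eapply Rle_lt_trans; [apply (Hmin x0 y0 t); lra|]. unfold S.
  replace (x0 - x0) with 0 by ring. replace (y0 - y0) with 0 by ring.
  assert (0 <= A * ((t * / R0) * (t * / R0))) by (apply Rmult_le_pos; [lra|apply Rle_0_sqr]). lra. }
assert (Hv : u x1 (y1 + t1) - u x1 (y1 - t1) <= 2 * M).
{ pose proof (HM x1 (y1 + t1)) as G1. pose proof (HM x1 (y1 - t1)) as G2.
  apply Rabs_le_between in G1. apply Rabs_le_between in G2. lra. }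
assert (Ht01 : 0 <= t1 * / R0 <= 1).
{ split; [apply Rmult_le_pos; lra|]. rewrite <- Hi1. apply Rmult_le_compat_r; lra. }
assert (HS1 : 0 <= A * (2 * (t1 * / R0) - (t1 * / R0) * (t1 * / R0))).
{ apply Rmult_le_pos; [lra|nra]. }
assert (HS2 : 0 <= 2 * M * (((x1 - x0) * / R0) * ((x1 - x0) * / R0))).
{ apply Rmult_le_pos; [lra|apply Rle_0_sqr]. }
assert (HS3 : 0 <= 2 * M * (((y1 - y0) * / (R0 * R0)) * ((y1 - y0) * / (R0 * R0)))).
{ apply Rmult_le_pos; [lra|apply Rle_0_sqr]. }
(* The negative minimum is interior. At [t = 0] the difference vanishes and [S >= 0]; at [t = R0],
   [S >= A > 2 * M]; on the lateral faces [S >= 2 * M]. If [M = 0] the difference is at most [0]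
   everywhere. *)
assert (It : 0 < t1 < R0).
{ split; apply Rnot_le_lt; intros Hle.
  - assert (t1 = 0) by lra. subst t1. unfold S in Hneg.
    rewrite Rplus_0_r, Rminus_0_r in Hneg. lra.
  - assert (t1 = R0) by lra. subst t1. unfold S in Hneg. rewrite Hi1 in Hneg. lra. }
assert (Ix : x0 - R0 < x1 < x0 + R0).
{ assert (HH : ((x1 - x0) * / R0) * ((x1 - x0) * / R0) < 1 \/ M = 0).
  { destruct (Req_dec M 0); [auto|left]. apply Rnot_le_lt. intros Hle. unfold S in Hneg.
    assert (2 * M * 1 <= 2 * M * (((x1 - x0) * / R0) * ((x1 - x0) * / R0)))
      by (apply Rmult_le_compat_l; lra). lra. }
  destruct HH as [HH|HH].
  - split; apply Rnot_le_lt; intros Hle.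
    + replace (x1 - x0) with (- R0) in HH by lra.
      replace (- R0 * / R0) with (-1) in HH by (field; lra). lra.
    + replace (x1 - x0) with R0 in HH by lra. rewrite Hi1 in HH. lra.
  - exfalso. unfold S in Hneg. lra. }
assert (Iy : y0 - R0 * R0 < y1 < y0 + R0 * R0).
{ assert (HH : ((y1 - y0) * / (R0 * R0)) * ((y1 - y0) * / (R0 * R0)) < 1 \/ M = 0).
  { destruct (Req_dec M 0); [auto|left]. apply Rnot_le_lt. intros Hle. unfold S in Hneg.
    assert (2 * M * 1 <= 2 * M * (((y1 - y0) * / (R0 * R0)) * ((y1 - y0) * / (R0 * R0))))
      by (apply Rmult_le_compat_l; lra). lra. }
  destruct HH as [HH|HH].
  - split; apply Rnot_le_lt; intros Hle.
    + replace (y1 - y0) with (- (R0 * R0)) in HH by lra.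
      replace (- (R0 * R0) * / (R0 * R0)) with (-1) in HH by (field; lra). lra.
    + replace (y1 - y0) with (R0 * R0) in HH by lra. rewrite Hi2 in HH. lra.
  - exfalso. unfold S in Hneg. lra. }
destruct (local_min_test (fun x => S x y1 t1) (fun x => u x (y1 + t1) - u x (y1 - t1))
  (fun x => 4 * M * (x - x0) * / (R0 * R0)) (fun x => ux x (y1 + t1) - ux x (y1 - t1))
  (4 * M * / (R0 * R0)) (uxx x1 (y1 + t1) - uxx x1 (y1 - t1)) x1
  (Rmin (x0 + R0 - x1) (x1 - (x0 - R0)))) as [_ Txx].
{ apply Rmin_glb_lt; lra. }
{ intros x Hd. apply (Hmin x y1 t1); try lra.
  pose proof (Rmin_l (x0 + R0 - x1) (x1 - (x0 - R0))).
  pose proof (Rmin_r (x0 + R0 - x1) (x1 - (x0 - R0))).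
  apply Rabs_def2 in Hd. lra. }
{ intros x. unfold S. auto_derive; auto. field. lra. }
{ intros x. apply (is_derive_minus (fun x => u x (y1 + t1)) (fun x => u x (y1 - t1))); apply Hx. }
{ auto_derive; auto. field. lra. }
{ apply (is_derive_minus (fun x => ux x (y1 + t1)) (fun x => ux x (y1 - t1))); apply Hxx. }
destruct (local_min_test (fun y => S x1 y t1) (fun y => u x1 (y + t1) - u x1 (y - t1))
  (fun y => 4 * M * (y - y0) * / (R0 * R0 * (R0 * R0))) (fun y => uy x1 (y + t1) - uy x1 (y - t1))
  (4 * M * / (R0 * R0 * (R0 * R0))) (uyy x1 (y1 + t1) - uyy x1 (y1 - t1)) y1
  (Rmin (y0 + R0 * R0 - y1) (y1 - (y0 - R0 * R0)))) as [Ty _].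
{ apply Rmin_glb_lt; lra. }
{ intros y Hd. apply (Hmin x1 y t1); try lra.
  pose proof (Rmin_l (y0 + R0 * R0 - y1) (y1 - (y0 - R0 * R0))).
  pose proof (Rmin_r (y0 + R0 * R0 - y1) (y1 - (y0 - R0 * R0))).
  apply Rabs_def2 in Hd. lra. }
{ intros y. unfold S. auto_derive; auto. field. lra. }
{ intros y. apply (is_derive_minus (fun y => u x1 (y + t1)) (fun y => u x1 (y - t1))).
  - apply (is_derive_shift (u x1)), Hy.
  - apply (is_derive_shift (u x1) y (- t1)), Hy. }
{ auto_derive; auto. field. lra. }
{ apply (is_derive_minus (fun y => uy x1 (y + t1)) (fun y => uy x1 (y - t1))).
  - apply (is_derive_shift (uy x1)), Hyy.
  - apply (is_derive_shift (uy x1) y1 (- t1)), Hyy. }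
(* The second [t]-derivative of the difference equals its second [y]-derivative, so the [uyy] terms
   are tested in [t]; the test in [y] served only for the drift. *)
destruct (local_min_test (fun t => S x1 y1 t) (fun t => u x1 (y1 + t) - u x1 (y1 - t))
  (fun t => 2 * A * / R0 - 2 * A * t * / (R0 * R0)) (fun t => uy x1 (y1 + t) - - uy x1 (y1 - t))
  (- (2 * A * / (R0 * R0))) (uyy x1 (y1 + t1) - - - uyy x1 (y1 - t1)) t1
  (Rmin (R0 - t1) t1)) as [_ Ttt].
{ apply Rmin_glb_lt; lra. }
{ intros t' Hd. apply (Hmin x1 y1 t'); try lra.
  pose proof (Rmin_l (R0 - t1) t1). pose proof (Rmin_r (R0 - t1) t1).
  apply Rabs_def2 in Hd. lra. }
{ intros s. unfold S. auto_derive; auto. field. lra. }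
{ intros s. apply (is_derive_minus (fun s => u x1 (y1 + s)) (fun s => u x1 (y1 - s))).
  - apply (is_derive_ext (fun s => u x1 (s + y1))); [intros; f_equal; ring|].
    apply (is_derive_shift (u x1)). rewrite Rplus_comm. apply Hy.
  - apply (is_derive_reflect (u x1)), Hy. }
{ auto_derive; auto. field. lra. }
{ apply (is_derive_minus (fun s => uy x1 (y1 + s)) (fun s => - uy x1 (y1 - s))).
  - apply (is_derive_ext (fun s => uy x1 (s + y1))); [intros; f_equal; ring|].
    apply (is_derive_shift (uy x1)). rewrite Rplus_comm. apply Hyy.
  - apply (is_derive_opp (fun s => uy x1 (y1 - s))), (is_derive_reflect (uy x1)), Hyy. }
assert (G1 : Rabs (uxx x1 (y1 + t1) + uyy x1 (y1 + t1) + b x1 * uy x1 (y1 + t1)) <= g).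
{ apply Hg; apply Rabs_le; lra. }
assert (G2 : Rabs (uxx x1 (y1 - t1) + uyy x1 (y1 - t1) + b x1 * uy x1 (y1 - t1)) <= g).
{ apply Hg; apply Rabs_le; lra. }
apply Rabs_le_between in G1. apply Rabs_le_between in G2.
(* At the contact point the [y]-derivative of the difference is that of [S], of size at most
   [4 * M / R0^2]. *)
assert (Hby : b x1 * (uy x1 (y1 + t1) - uy x1 (y1 - t1)) <= 4 * M * B * / (R0 * R0)).
{ rewrite <- Ty. set (e := (y1 - y0) * / (R0 * R0)).
  assert (He : Rabs e <= 1).
  { apply Rabs_le. unfold e. rewrite <- Hi2. split.
    - replace (- (R0 * R0 * / (R0 * R0))) with (- (R0 * R0) * / (R0 * R0)) by ring.
      apply Rmult_le_compat_r; lra.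
    - apply Rmult_le_compat_r; lra. }
  replace (b x1 * (4 * M * (y1 - y0) * / (R0 * R0 * (R0 * R0))))
    with ((4 * M * / (R0 * R0)) * (b x1 * e)) by (unfold e; field; lra).
  replace (4 * M * B * / (R0 * R0)) with ((4 * M * / (R0 * R0)) * (B * 1)) by ring.
  apply Rmult_le_compat_l; [apply Rmult_le_pos; lra|].
  eapply Rle_trans; [apply Rle_abs|]. rewrite Rabs_mult.
  apply Rmult_le_compat; auto using Rabs_pos. }
assert (HAe : 2 * A * / (R0 * R0) = 8 * M * / (R0 * R0) + 2 * (4 * M * B * / (R0 * R0)) + 2 * g + 2 * / (R0 * R0)).
{ unfold A. field. lra. }
assert (0 <= 4 * M * / (R0 * R0)) by (apply Rmult_le_pos; lra).
assert (0 <= 4 * M * B * / (R0 * R0)) by (apply Rmult_le_pos; nra).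
lra.
Qed.

(** * Propagation of positivity by Hopf's barrier *)

Lemma exp_le (a b : R) : a <= b -> exp a <= exp b.
Proof.
intros [H|H]; [left; apply exp_increasing, H|right; rewrite H; reflexivity].
Qed.

(** A quantitative strong maximum principle. The factor [c] is fixed before the function and the
    centre, which makes the bound uniform over translates. It is the barrier's value at radius [R0],
    positive because the barrier vanishes only at radius [R0 + 1]. *)
Lemma harnack (B K r R0 : R) : 0 < r -> 0 < R0 -> 0 <= K -> 0 <= B ->
  exists c, 0 < c /\ forall u ux uy uxx uyy b x0 y0 mu,
    axis_C2 u ux uy uxx uyy ->
    (forall x, Rabs (b x) <= B) ->
    (forall x y, 0 <= u x y) ->
    (forall x y, uxx x y + uyy x y + b x * uy x y <= K * u x y) ->
    0 < mu ->
    (forall x y, (x - x0) ^ 2 + (y - y0) ^ 2 <= r ^ 2 -> mu <= u x y) ->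
    forall x y, (x - x0) ^ 2 + (y - y0) ^ 2 <= R0 ^ 2 -> c * mu <= u x y.
Proof.
intros Hr HR HK HB.
set (S := R0 + 1).
set (A := (5 + 2 * B * S + K) / (4 * r ^ 2) + 1).
assert (Hr2 : 0 < r ^ 2) by nra.
assert (HBS : 0 <= B * S) by (unfold S; nra).
assert (HA1 : 1 <= A).
{ unfold A. assert (0 <= (5 + 2 * B * S + K) / (4 * r ^ 2)); [|lra].
  apply Rdiv_le_0_compat; lra. }
(* At squared radius [rho >= r^2], the operator applied to the exponential is the exponential times
   [4 A^2 rho - 4 A - 2 A b (y - y0)]. Since [A >= 1], this inequality makes that factor exceed
   [K]. *)
assert (HA : 4 + 2 * B * S + K < 4 * A * r ^ 2).
{ unfold A. replace (4 * ((5 + 2 * B * S + K) / (4 * r ^ 2) + 1) * r ^ 2)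
    with (5 + 2 * B * S + K + 4 * r ^ 2) by (field; lra). lra. }
exists (exp (- A * R0 ^ 2) - exp (- A * S ^ 2)).
split.
{ apply Rlt_0_minus, exp_increasing. unfold S. nra. }
intros u ux uy uxx uyy b x0 y0 mu Hu Hb Hpos HL Hmu Hball x y Hxy.
destruct Hu as (Hc & Hx & Hy & Hxx & Hyy).
(* Hopf's barrier on the annulus [r <= |z - z0| <= S]; [A] is chosen so that [LH > K H] there *)
set (H := fun x y => exp (- A * ((x - x0) * (x - x0) + (y - y0) * (y - y0))) - exp (- A * S ^ 2)).
(* The third coordinate is a dummy ranging over the single point [0]. *)
destruct (box_min (x0 - S) (x0 + S) (y0 - S) (y0 + S) 0 0 (fun x y _ => u x y - mu * H x y))
  as (x1 & y1 & t1 & Hx1 & Hy1 & _ & Hmin); try (unfold S; lra).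
{ intros p. unfold H. prove_continuous. apply continuous_uncurry; auto; prove_continuous. }
assert (HSp : 0 < S) by (unfold S; lra).
assert (Hsq : forall z w, z * z + w * w < S ^ 2 -> - S < z < S).
{ intros z w Hzw. assert (0 <= w * w) by apply Rle_0_sqr.
  split; apply Rnot_le_lt; intros Hle; assert (S * S <= z * z) by nra; lra. }
(* A negative minimum would lie strictly inside the annulus: beyond radius [S] one has
   [H <= 0 <= u], and within radius [r] one has [mu * H <= mu <= u]. *)
assert (Hge : 0 <= u x1 y1 - mu * H x1 y1).
{ apply Rnot_lt_le. intros Hlt.
  assert (HS : (x1 - x0) * (x1 - x0) + (y1 - y0) * (y1 - y0) < S ^ 2).
  { apply Rnot_le_lt. intros Hle. assert (H x1 y1 <= 0).
    { unfold H. apply Rle_minus. apply exp_le. nra. }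
    specialize (Hpos x1 y1). nra. }
  assert (Hrr : r ^ 2 < (x1 - x0) * (x1 - x0) + (y1 - y0) * (y1 - y0)).
  { apply Rnot_le_lt. intros Hle. assert (H x1 y1 <= 1).
    { unfold H. pose proof (exp_pos (- A * S ^ 2)).
      assert (exp (- A * ((x1 - x0) * (x1 - x0) + (y1 - y0) * (y1 - y0))) <= exp 0) as He.
      { apply exp_le. rewrite Ropp_mult_distr_l_reverse. apply Ropp_le_cancel.
        rewrite Ropp_0, Ropp_involutive. apply Rmult_le_pos; [lra|].
        apply Rplus_le_le_0_compat; apply Rle_0_sqr. }
      rewrite exp_0 in He. lra. }
    specialize (Hball x1 y1 ltac:(nra)). nra. }
  assert (Ix : x0 - S < x1 < x0 + S) by (apply Hsq in HS; lra).
  assert (Iy : y0 - S < y1 < y0 + S) by (rewrite Rplus_comm in HS; apply Hsq in HS; lra).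
  set (e := exp (- A * ((x1 - x0) * (x1 - x0) + (y1 - y0) * (y1 - y0)))).
  destruct (local_min_test (fun x => u x y1) (fun x => mu * H x y1)
    (fun x => ux x y1)
    (fun x => mu * (- 2 * A * (x - x0) * exp (- A * ((x - x0) * (x - x0) + (y1 - y0) * (y1 - y0)))))
    (uxx x1 y1) (mu * ((4 * A ^ 2 * (x1 - x0) ^ 2 - 2 * A) * e)) x1
    (Rmin (x0 + S - x1) (x1 - (x0 - S)))) as [_ Txx].
  { apply Rmin_glb_lt; lra. }
  { intros z Hd. apply (Hmin z y1 0); try lra.
    pose proof (Rmin_l (x0 + S - x1) (x1 - (x0 - S))).
    pose proof (Rmin_r (x0 + S - x1) (x1 - (x0 - S))).
    apply Rabs_def2 in Hd. lra. }
  { intros z. apply Hx. }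
  { intros z. unfold H. auto_derive; auto. unfold Rminus. ring. }
  { apply Hxx. }
  { unfold e. auto_derive; auto. unfold Rminus. ring. }
  destruct (local_min_test (fun y => u x1 y) (fun y => mu * H x1 y)
    (fun y => uy x1 y)
    (fun y => mu * (- 2 * A * (y - y0) * exp (- A * ((x1 - x0) * (x1 - x0) + (y - y0) * (y - y0)))))
    (uyy x1 y1) (mu * ((4 * A ^ 2 * (y1 - y0) ^ 2 - 2 * A) * e)) y1
    (Rmin (y0 + S - y1) (y1 - (y0 - S)))) as [Ty Tyy].
  { apply Rmin_glb_lt; lra. }
  { intros z Hd. apply (Hmin x1 z 0); try lra.
    pose proof (Rmin_l (y0 + S - y1) (y1 - (y0 - S))).
    pose proof (Rmin_r (y0 + S - y1) (y1 - (y0 - S))).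
    apply Rabs_def2 in Hd. lra. }
  { intros z. apply Hy. }
  { intros z. unfold H. auto_derive; auto. unfold Rminus. ring. }
  { apply Hyy. }
  { unfold e. auto_derive; auto. unfold Rminus. ring. }
  fold e in Ty.
  specialize (HL x1 y1). rewrite Ty in HL.
  assert (He : 0 < e) by apply exp_pos.
  assert (HHe : H x1 y1 < e) by (unfold H, e; pose proof (exp_pos (- A * S ^ 2)); lra).
  assert (Hby : - (B * S) <= b x1 * (y1 - y0) <= B * S).
  { apply Rabs_le_between. rewrite Rabs_mult. apply Rmult_le_compat; auto using Rabs_pos.
    apply Rabs_le. lra. }
  (* Negativity at the minimum gives [u < mu * H < mu * e], which turns the zero-order term into a
     multiple of the barrier. *)
  assert (Hu1 : K * u x1 y1 <= K * (mu * e)) by (apply Rmult_le_compat_l; nra).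
  set (rho := (x1 - x0) * (x1 - x0) + (y1 - y0) * (y1 - y0)) in *.
  assert (Hsum : mu * e * (4 * A ^ 2 * rho - 4 * A - 2 * A * (b x1 * (y1 - y0)) - K) <= 0).
  { unfold rho. lra. }
  assert (0 < 4 * A ^ 2 * rho - 4 * A - 2 * A * (b x1 * (y1 - y0)) - K) as Hp.
  { assert (A * (4 * A * r ^ 2) <= 4 * A ^ 2 * rho) by nra.
    assert (A * (4 + 2 * B * S + K) < A * (4 * A * r ^ 2)) by (apply Rmult_lt_compat_l; lra).
    assert (A * (b x1 * (y1 - y0)) <= A * (B * S)) by (apply Rmult_le_compat_l; lra).
    nra. }
  assert (0 < mu * e) by nra. nra. }
assert (HH : 0 <= u x y - mu * H x y).
{ eapply Rle_trans; [exact Hge|]. assert (HRS : R0 ^ 2 < S ^ 2) by (unfold S; nra).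
  pose proof (Hsq (x - x0) (y - y0) ltac:(lra)). pose proof (Hsq (y - y0) (x - x0) ltac:(lra)).
  apply (Hmin x y 0); lra. }
assert (exp (- A * R0 ^ 2) - exp (- A * S ^ 2) <= H x y).
{ unfold H. apply Rplus_le_compat_r. apply exp_le. nra. }
nra.
Qed.

(** * Closure of the regularity class and Lipschitz bounds *)

Lemma axis_C2_shift_diff (u ux uy uxx uyy : R -> R -> R) (h : R) :
  axis_C2 u ux uy uxx uyy ->
  axis_C2 (fun x y => u x (y + h) - u x y) (fun x y => ux x (y + h) - ux x y)
    (fun x y => uy x (y + h) - uy x y) (fun x y => uxx x (y + h) - uxx x y)
    (fun x y => uyy x (y + h) - uyy x y).
Proof.
intros (Hc & Hx & Hy & Hxx & Hyy). split; [|split; [|split; [|split]]].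
- intros p. prove_continuous; apply continuous_uncurry; auto; prove_continuous.
- intros x y. apply (is_derive_minus (fun s => u s (y + h)) (fun s => u s y)); auto.
- intros x y. apply (is_derive_minus (fun t => u x (t + h)) (fun t => u x t)); auto.
  apply (is_derive_shift (u x)); auto.
- intros x y. apply (is_derive_minus (fun s => ux s (y + h)) (fun s => ux s y)); auto.
- intros x y. apply (is_derive_minus (fun t => uy x (t + h)) (fun t => uy x t)); auto.
  apply (is_derive_shift (uy x)); auto.
Qed.

Lemma axis_C2_opp (u ux uy uxx uyy : R -> R -> R) :
  axis_C2 u ux uy uxx uyy ->
  axis_C2 (fun x y => - u x y) (fun x y => - ux x y)
    (fun x y => - uy x y) (fun x y => - uxx x y) (fun x y => - uyy x y).
Proof.
intros (Hc & Hx & Hy & Hxx & Hyy). split; [|split; [|split; [|split]]].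
- intros p. prove_continuous; auto.
- intros x y. apply (is_derive_opp (fun s => u s y)); auto.
- intros x y. apply (is_derive_opp (fun s => u x s)); auto.
- intros x y. apply (is_derive_opp (fun s => ux s y)); auto.
- intros x y. apply (is_derive_opp (fun s => uy x s)); auto.
Qed.

(** Exchanging the axes lets the estimate for differences in [y] control differences in [x] too. *)
Lemma axis_C2_swap (u ux uy uxx uyy : R -> R -> R) :
  axis_C2 u ux uy uxx uyy ->
  axis_C2 (fun x y => u y x) (fun x y => uy y x) (fun x y => ux y x)
    (fun x y => uyy y x) (fun x y => uxx y x).
Proof.
intros (Hc & Hx & Hy & Hxx & Hyy). split; [|auto].
intros p. apply continuous_uncurry; auto; prove_continuous.
Qed.

Lemma sym_diff_abs_bound (u ux uy uxx uyy : R -> R -> R) (b : R -> R) (M B g R0 x0 y0 t : R) :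
  axis_C2 u ux uy uxx uyy ->
  0 < R0 ->
  (forall x y, Rabs (u x y) <= M) ->
  (forall x, Rabs (b x) <= B) ->
  (forall x y, Rabs (x - x0) <= R0 -> Rabs (y - y0) <= R0 * R0 + R0 ->
    Rabs (uxx x y + uyy x y + b x * uy x y) <= g) ->
  0 <= t <= R0 ->
  Rabs (u x0 (y0 + t) - u x0 (y0 - t)) <=
    (4 * M + 4 * M * B + g * (R0 * R0) + 1) * (2 * (t * / R0)).
Proof.
intros Hu HR HM HB Hg Ht. apply Rabs_le.
pose proof (sym_diff_bound _ _ _ _ _ b M B g R0 x0 y0 t Hu HR HM HB Hg Ht) as H1.
pose proof (sym_diff_bound _ _ _ _ _ b M B g R0 x0 y0 t (axis_C2_opp _ _ _ _ _ Hu) HR) as H2.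
cut (- u x0 (y0 + t) - - u x0 (y0 - t) <=
    (4 * M + 4 * M * B + g * (R0 * R0) + 1) * (2 * (t * / R0))); [lra|].
apply H2; auto.
- intros x y. rewrite Rabs_Ropp. apply HM.
- intros x y Hx Hy.
  replace (- uxx x y + - uyy x y + b x * - uy x y)
    with (- (uxx x y + uyy x y + b x * uy x y)) by ring.
  rewrite Rabs_Ropp. apply Hg; auto.
Qed.

Lemma derive_bound_of_sym_diff (g : R -> R) (y l A : R) :
  is_derive g y l ->
  (forall t, 0 <= t <= 1 -> Rabs (g (y + t) - g (y - t)) <= A * (2 * t)) ->
  Rabs l <= A.
Proof.
intros Hg Hd. apply Rnot_lt_le. intros Hlt.
apply is_derive_Reals in Hg.
(* With this tolerance on both sides of [y], the hypothesis yields [Rabs l * t <= A * t + (Rabs l -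
   A) / 2 * t], impossible when [A < Rabs l]. *)
destruct (Hg ((Rabs l - A) / 2)) as [del Hdel]; [lra|].
set (t := Rmin (del / 2) 1).
assert (Ht : 0 < t /\ t < del /\ t <= 1).
{ pose proof (cond_pos del). unfold t. split; [apply Rmin_glb_lt; lra|].
  pose proof (Rmin_l (del / 2) 1); pose proof (Rmin_r (del / 2) 1). lra. }
assert (H1 : Rabs (g (y + t) - g y - l * t) < (Rabs l - A) / 2 * t).
{ pose proof (Hdel t ltac:(lra)) as H. rewrite Rabs_pos_eq in H by lra. specialize (H ltac:(lra)).
  replace (g (y + t) - g y - l * t) with (((g (y + t) - g y) / t - l) * t) by (field; lra).
  rewrite Rabs_mult, (Rabs_pos_eq t) by lra. apply Rmult_lt_compat_r; lra. }
assert (H2 : Rabs (g (y - t) - g y + l * t) < (Rabs l - A) / 2 * t).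
{ pose proof (Hdel (- t) ltac:(lra)) as H. rewrite Rabs_Ropp, Rabs_pos_eq in H by lra.
  specialize (H ltac:(lra)). replace (y + - t) with (y - t) in H by ring.
  replace (g (y - t) - g y + l * t) with (- (((g (y - t) - g y) / - t - l) * t)) by (field; lra).
  rewrite Rabs_Ropp, Rabs_mult, (Rabs_pos_eq t) by lra. apply Rmult_lt_compat_r; lra. }
specialize (Hd t ltac:(lra)).
apply Rabs_def2 in H1. apply Rabs_def2 in H2. apply Rabs_le_between in Hd.
assert (Hlt' : Rabs (l * t) <= A * t + (Rabs l - A) / 2 * t) by (apply Rabs_le; lra).
rewrite Rabs_mult, (Rabs_pos_eq t) in Hlt' by lra. nra.
Qed.

Lemma lipschitz_of_derive_bound (g g1 : R -> R) (A : R) :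
  (forall x, is_derive g x (g1 x)) -> (forall x, Rabs (g1 x) <= A) ->
  forall x y, Rabs (g x - g y) <= A * Rabs (x - y).
Proof.
intros Hg HA x y.
destruct (MVT_gen g y x g1) as [xi [_ Hxi]].
- intros; apply Hg.
- intros z _. apply continuity_pt_filterlim, (ex_derive_continuous g). eexists; apply Hg.
- rewrite Hxi, Rabs_mult. apply Rmult_le_compat_r; [apply Rabs_pos|apply HA].
Qed.

Lemma sqrt_1_sqr_lipschitz (x y : R) :
  Rabs (sqrt (1 + x * x) - sqrt (1 + y * y)) <= Rabs (x - y).
Proof.
rewrite <- (Rmult_1_l (Rabs (x - y))).
apply (lipschitz_of_derive_bound (fun x => sqrt (1 + x * x)) (fun x => x / sqrt (1 + x * x))).
- intros z. assert (0 < 1 + z * z) by nra. auto_derive; auto. field.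
  apply Rgt_not_eq, sqrt_lt_R0; auto.
- intros z. assert (Hz : 0 < 1 + z * z) by nra. pose proof (sqrt_lt_R0 _ Hz).
  unfold Rdiv. rewrite Rabs_mult, Rabs_inv, (Rabs_pos_eq (sqrt _)) by lra.
  apply Rmult_le_reg_r with (sqrt (1 + z * z)); auto.
  rewrite Rmult_assoc, Rinv_l, Rmult_1_r, Rmult_1_l by lra.
  rewrite <- sqrt_Rsqr_abs. apply sqrt_le_1_alt. unfold Rsqr. lra.
Qed.

(** * The sliding argument for an abstract drift and reaction term *)

Section Sliding.

Variables (phi phix phiy phixx phiyy : R -> R -> R) (b f : R -> R) (B M K k theta rho : R).

Hypothesis phi_C2 : axis_C2 phi phix phiy phixx phiyy.
Hypothesis b_bound : forall x, Rabs (b x) <= B.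
Hypothesis phi_bound : forall x y, Rabs (phi x y) <= M.
Hypothesis pde : forall x y, phixx x y + phiyy x y + b x * phiy x y + f (phi x y) = 0.
Hypothesis f_lip : forall u v, Rabs (f u - f v) <= K * Rabs (u - v).
Hypothesis theta_pos : 0 < theta.
(** The conditions on [f] are imposed on half-lines because [phi] is only known to be bounded and
    might a priori leave [[0, 1]]. *)
Hypothesis f_low : forall u, u <= theta -> f u = 0.
Hypothesis f_high : forall u, 1 <= u -> f u = 0.
Hypothesis rho_pos : 0 < rho.
Hypothesis f_decr : forall u v, 1 - rho <= u -> u <= v -> f v <= f u.

(* smooth substitute for the cone coordinate [y + k |x|] *)
Let sigma (x y : R) := y + k * sqrt (1 + x * x).

Hypothesis phi_low : forall eps, 0 < eps -> exists l, forall x y, sigma x y <= l -> phi x y < eps.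
Hypothesis phi_high : forall eps, 0 < eps -> exists l, forall x y, l <= sigma x y -> 1 - eps < phi x y.

Let w (h x y : R) := phi x (y + h) - phi x y.

Lemma K_nonneg : 0 <= K.
Proof.
pose proof (f_lip 1 0) as H. rewrite Rminus_0_r, Rabs_R1, Rmult_1_r in H.
eapply Rle_trans; [apply Rabs_pos|exact H].
Qed.

Lemma B_nonneg : 0 <= B.
Proof. eapply Rle_trans; [apply Rabs_pos|apply (b_bound 0)]. Qed.

Lemma M_nonneg : 0 <= M.
Proof. eapply Rle_trans; [apply Rabs_pos|apply (phi_bound 0 0)]. Qed.

Lemma sigma_lipschitz x y x' y' :
  Rabs (sigma x' y' - sigma x y) <= Rabs k * Rabs (x' - x) + Rabs (y' - y).
Proof.
unfold sigma.
replace (y' + k * sqrt (1 + x' * x') - (y + k * sqrt (1 + x * x)))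
  with (k * (sqrt (1 + x' * x') - sqrt (1 + x * x)) + (y' - y)) by ring.
eapply Rle_trans; [apply Rabs_triang|]. apply Rplus_le_compat_r.
rewrite Rabs_mult. apply Rmult_le_compat_l; [apply Rabs_pos|apply sqrt_1_sqr_lipschitz].
Qed.

Lemma phi_lipschitz : exists C, 0 < C /\ forall x y x' y',
  Rabs (phi x y - phi x' y') <= C * (Rabs (x - x') + Rabs (y - y')).
Proof.
pose proof K_nonneg as HK. pose proof B_nonneg as HB. pose proof M_nonneg as HM.
(* From [f 1 = 0]: [Rabs (f u) <= K * Rabs (u - 1)]. *)
set (F := K * (M + 1)).
assert (HF : forall x y, Rabs (f (phi x y)) <= F).
{ intros x y. replace (f (phi x y)) with (f (phi x y) - f 1) by (rewrite (f_high 1); lra).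
  eapply Rle_trans; [apply f_lip|]. apply Rmult_le_compat_l; auto.
  pose proof (phi_bound x y) as H. apply Rabs_le_between in H. apply Rabs_le. lra. }
set (A1 := 4 * M + 4 * M * B + F * (1 * 1) + 1).
assert (H1 : forall x y, Rabs (phiy x y) <= A1).
{ intros x y. destruct phi_C2 as (_ & _ & Hy & _ & _).
  apply (derive_bound_of_sym_diff (phi x) y _ _ (Hy x y)). intros t Ht.
  replace (2 * t) with (2 * (t * / 1)) by field.
  apply (sym_diff_abs_bound _ _ _ _ _ b M B F 1 x y t phi_C2); auto; try lra.
  intros x' y' _ _. replace (phixx x' y' + phiyy x' y' + b x' * phiy x' y') with (- f (phi x' y'))
    by (specialize (pde x' y'); lra).
  rewrite Rabs_Ropp. auto. }
(* After the swap [b] would depend on the doubled variable, which the estimate does not allow. With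
   [phiy] already bounded by [A1], the drift moves to the right-hand side and the estimate is
   applied with drift [0]. *)
set (A2 := 4 * M + 4 * M * 0 + (F + B * A1) * (1 * 1) + 1).
assert (H2 : forall x y, Rabs (phix x y) <= A2).
{ intros x y. destruct phi_C2 as (_ & Hx & _ & _ & _).
  apply (derive_bound_of_sym_diff (fun s => phi s y) x _ _ (Hx x y)). intros t Ht.
  replace (2 * t) with (2 * (t * / 1)) by field.
  apply (sym_diff_abs_bound _ _ _ _ _ (fun _ => 0) M 0 (F + B * A1) 1 y x t (axis_C2_swap _ _ _ _ _ phi_C2));
    auto; try lra.
  - intros _. rewrite Rabs_R0. lra.
  - intros x' y' _ _. replace (phiyy y' x' + phixx y' x' + 0 * phix y' x')
      with (- f (phi y' x') + - (b y' * phiy y' x')) by (specialize (pde y' x'); lra).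
    eapply Rle_trans; [apply Rabs_triang|]. rewrite !Rabs_Ropp, Rabs_mult.
    apply Rplus_le_compat; auto. apply Rmult_le_compat; auto using Rabs_pos. }
assert (HA1 : 0 <= A1) by (eapply Rle_trans; [apply Rabs_pos|apply (H1 0 0)]).
assert (HA2 : 0 <= A2) by (eapply Rle_trans; [apply Rabs_pos|apply (H2 0 0)]).
exists (A1 + A2 + 1). split; [lra|]. intros x y x' y'.
destruct phi_C2 as (_ & Hx & Hy & _ & _).
pose proof (lipschitz_of_derive_bound (fun s => phi s y) _ A2 (fun s => Hx s y) (fun s => H2 s y) x x') as L1.
pose proof (lipschitz_of_derive_bound (phi x') _ A1 (Hy x') (H1 x') y y') as L2.
simpl in L1.
replace (phi x y - phi x' y') with ((phi x y - phi x' y) + (phi x' y - phi x' y')) by ring.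
eapply Rle_trans; [apply Rabs_triang|].
pose proof (Rabs_pos (x - x')). pose proof (Rabs_pos (y - y')). nra.
Qed.

Lemma shift_diff_decay (h eps : R) : 0 < h -> 0 < eps ->
  exists l, 0 < l /\ forall x y, l <= Rabs (sigma x y) -> Rabs (w h x y) <= eps.
Proof.
intros Hh Heps.
pose proof K_nonneg as HK. pose proof B_nonneg as HB. pose proof M_nonneg as HM.
set (A := 4 * M + 4 * M * B + 2).
assert (HMB : 0 <= M * B) by (apply Rmult_le_pos; lra).
assert (HA : 0 < A) by (unfold A; lra).
(* The first term makes [A * h / R0 <= eps], the second makes [t = h / 2] admissible. [A] is the
   constant of the difference estimate once [g * R0^2 = 1]. *)
set (R0 := A * h / eps + h).
assert (HRe : A * h <= eps * R0).
{ unfold R0. replace (eps * (A * h / eps + h)) with (A * h + eps * h) by (field; lra). nra. }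
assert (HRh : h <= R0).
{ unfold R0. assert (0 <= A * h / eps); [|lra]. apply Rdiv_le_0_compat; nra. }
assert (HR : 0 < R0) by lra.
set (g := / (R0 * R0)).
assert (Hg : 0 < g) by (apply Rinv_0_lt_compat; nra).
destruct (phi_low theta theta_pos) as [l1 Hl1].
(* If [1 - g / (K + 1) < phi < 1] then [f phi <= g]; the [+ 1] covers [K = 0]. *)
assert (He : 0 < g / (K + 1)) by (apply Rdiv_lt_0_compat; lra).
destruct (phi_high _ He) as [l2 Hl2].
(* Bounds the change of [sigma] between [(x, y)] and any point of the box centred at
   [(x, y + h / 2)], the midpoint about which [w] is a symmetric difference. *)
set (D := Rabs k * R0 + (R0 * R0 + R0 + h)).
assert (HD : 0 < D) by (unfold D; pose proof (Rabs_pos k); nra).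
exists (Rabs l1 + Rabs l2 + D + 1).
pose proof (Rle_abs l1). pose proof (Rle_abs l2). pose proof (Rle_abs (- l1)) as Hm1.
rewrite Rabs_Ropp in Hm1. pose proof (Rabs_pos l1). pose proof (Rabs_pos l2).
split; [lra|]. intros x y Hxy. unfold w.
replace (y + h) with ((y + h / 2) + h / 2) by field.
replace (phi x y) with (phi x ((y + h / 2) - h / 2)) by (f_equal; field).
eapply Rle_trans.
- apply (sym_diff_abs_bound _ _ _ _ _ b M B g R0 x (y + h / 2) (h / 2) phi_C2); auto; try lra.
  intros x' y' Hx' Hy'.
  replace (phixx x' y' + phiyy x' y' + b x' * phiy x' y') with (- f (phi x' y'))
    by (specialize (pde x' y'); lra).
  rewrite Rabs_Ropp.
  assert (Hs : Rabs (sigma x' y' - sigma x y) <= D).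
  { eapply Rle_trans; [apply sigma_lipschitz|]. unfold D. apply Rplus_le_compat.
    - apply Rmult_le_compat_l; auto using Rabs_pos.
    - replace (y' - y) with ((y' - (y + h / 2)) + h / 2) by ring.
      eapply Rle_trans; [apply Rabs_triang|]. rewrite (Rabs_pos_eq (h / 2)) by lra. lra. }
  apply Rabs_le_between in Hs.
  destruct (Rle_lt_dec 0 (sigma x y)) as [Hp|Hp].
  + rewrite (Rabs_pos_eq (sigma x y)) in Hxy by lra.
    specialize (Hl2 x' y' ltac:(lra)).
    destruct (Rle_lt_dec 1 (phi x' y')) as [Hge|Hlt].
    * rewrite f_high, Rabs_R0; lra.
    * replace (f (phi x' y')) with (f (phi x' y') - f 1) by (rewrite (f_high 1); lra).
      eapply Rle_trans; [apply f_lip|]. rewrite Rabs_left by lra.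
      replace g with ((K + 1) * (g / (K + 1))) by (field; lra).
      apply Rmult_le_compat; lra.
  + rewrite (Rabs_left (sigma x y)) in Hxy by lra.
    specialize (Hl1 x' y' ltac:(lra)). rewrite f_low, Rabs_R0 by lra. lra.
- replace (4 * M + 4 * M * B + g * (R0 * R0) + 1) with A by (unfold A, g; field; lra).
  replace (A * (2 * (h / 2 * / R0))) with ((A * h) * / R0) by (field; lra).
  replace eps with ((eps * R0) * / R0) by (field; lra).
  apply Rmult_le_compat_r; auto. left. apply Rinv_0_lt_compat; lra.
Qed.

(** Decay confines very negative values of [w] to a strip, still unbounded in [x]. A small multiple
    of [sqrt (1 + x * x)] is therefore added to [w] to make a minimum exist; its second derivative
    is bounded, so the exponential absorbs it. *)
Lemma shift_diff_comparison (h : R) : 0 < h ->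
  (forall x y, w h x y < 0 -> phi x y <= theta \/ 1 - rho <= phi x (y + h)) ->
  forall x y, 0 <= w h x y.
Proof.
intros Hh Hcase x0 y0. apply Rnot_lt_le. intros Hlt.
pose proof B_nonneg as HB. pose proof M_nonneg as HM.
set (m := - w h x0 y0). assert (Hm : 0 < m) by (unfold m; lra).
destruct (shift_diff_decay h (m / 2) Hh) as [l [Hl Hdec]]; [lra|].
assert (Hin : forall x y, w h x y < - (m / 2) -> - l < sigma x y < l).
{ intros x y Hw. apply Rabs_lt_between. apply Rnot_le_lt. intros Hle.
  apply Hdec in Hle. apply Rabs_le_between in Hle. lra. }
set (p := fun x => sqrt (1 + x * x)).
assert (Hp1 : forall x, 1 <= p x).
{ intros x. unfold p. rewrite <- sqrt_1 at 1. apply sqrt_le_1_alt. nra. }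
assert (Hpx : forall x, Rabs x <= p x).
{ intros x. unfold p. rewrite <- sqrt_Rsqr_abs. apply sqrt_le_1_alt. unfold Rsqr. lra. }
assert (Hpp : forall x, p x * p x = 1 + x * x).
{ intros x. unfold p. apply sqrt_sqrt. nra. }
(* Makes [a - k * p'' - b >= 1], where [p''] lies between [0] and [1]; this is the gain of the
   exponential barrier. *)
set (a := Rabs k + B + 1).
assert (Ha : 1 <= a) by (unfold a; pose proof (Rabs_pos k); lra).
set (eta := m / 8 * exp (- a * l)).
pose proof (exp_pos (- a * l)) as Hel.
assert (Heta : 0 < eta) by (unfold eta; apply Rmult_lt_0_compat; lra).
assert (Hetal : eta * exp (a * l) = m / 8).
{ unfold eta. rewrite Rmult_assoc, <- exp_plus. replace (- a * l + a * l) with 0 by ring.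
  rewrite exp_0. ring. }
assert (Hea : 0 < eta * a) by (apply Rmult_lt_0_compat; lra).
assert (He1 : 0 < eta * a * exp (- a * l)) by (apply Rmult_lt_0_compat; auto).
(* The first bound keeps the added term below [m / 8] at [x0]; the second keeps its contribution to
   the operator below the exponential's gain on the strip. *)
set (eps := Rmin (m / 8 / p x0) (eta * a * exp (- a * l) / 2)).
assert (Heps : 0 < eps).
{ apply Rmin_glb_lt; [|lra]. apply Rdiv_lt_0_compat; [lra|]. specialize (Hp1 x0). lra. }
assert (Heps1 : eps * p x0 <= m / 8).
{ specialize (Hp1 x0). replace (m / 8) with (m / 8 / p x0 * p x0) by (field; lra).
  apply Rmult_le_compat_r; [lra|apply Rmin_l]. }
assert (Heps2 : eps < eta * a * exp (- a * l)).
{ eapply Rle_lt_trans; [apply Rmin_r|]. lra. }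
(* Wide enough to contain [x0] and to have [eps * p x > 2 * M] on the lateral sides, which keeps the
   minimum off them. *)
set (X := Rabs x0 + 2 * M / eps + 1).
assert (HX : 0 <= 2 * M / eps) by (apply Rdiv_le_0_compat; lra).
destruct (axis_C2_shift_diff _ _ _ _ _ h phi_C2) as (Wc & Wx & Wy & Wxx & Wyy).
assert (Hpc : forall q, continuous p q).
{ intros q. apply (ex_derive_continuous p). unfold p. auto_derive. nra. }
pose proof (Hin x0 y0 ltac:(unfold m; lra)) as Hs0.
pose proof (Rabs_pos x0) as Hx0.
(* coordinates [(x, sigma)], in which the strip [|sigma| <= l] is straight *)
destruct (box_min (- X) X (- l) l 0 0
  (fun x s _ => w h x (s - k * p x) - eta * exp (- a * s) + eps * p x))
  as (x1 & s1 & t1 & Hx1 & Hs1 & _ & Hmin); try (unfold X; lra).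
{ intros q. prove_continuous.
  - apply (continuous_uncurry (w h)); [exact Wc| |]; prove_continuous.
    apply (continuous_comp (fun q => fst (fst q)) p); [prove_continuous|apply Hpc].
  - apply (continuous_comp (fun q => fst (fst q)) p); [prove_continuous|apply Hpc]. }
set (y1 := s1 - k * p x1) in *.
assert (Hsy1 : s1 = y1 + k * p x1) by (unfold y1; ring).
assert (Hexp : eta * exp (- a * s1) <= m / 8).
{ rewrite <- Hetal. apply Rmult_le_compat_l; [lra|]. apply exp_le.
  replace (a * l) with (- a * - l) by ring. nra. }
(* Comparison with [(x0, y0)]: the corrections cost at most [m / 4], so [w < - (m / 2)] at the
   minimum and [Hin] keeps it off the edges of the strip. *)
assert (Hle0 : w h x1 y1 <= - m + eps * p x0 + m / 8 - eps * p x1).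
{ pose proof (Hmin x0 (sigma x0 y0) 0) as Hm0.
  assert (HH : sigma x0 y0 - k * p x0 = y0) by (unfold sigma, p; ring).
  rewrite HH in Hm0. pose proof (exp_pos (- a * sigma x0 y0)).
  assert (0 < eta * exp (- a * sigma x0 y0)) by (apply Rmult_lt_0_compat; auto).
  pose proof (Rle_abs x0). pose proof (Rle_abs (- x0)) as Hn. rewrite Rabs_Ropp in Hn.
  specialize (Hm0 ltac:(unfold X; lra) ltac:(lra) ltac:(lra)). unfold m in *. lra. }
assert (Hep1 : eps <= eps * p x1) by (specialize (Hp1 x1); nra).
assert (Is : - l < s1 < l).
{ rewrite Hsy1. apply (Hin x1 y1). lra. }
assert (Ix : - X < x1 < X).
{ assert (Hw1 : - (2 * M) <= w h x1 y1).
  { unfold w. pose proof (phi_bound x1 y1) as Q1. pose proof (phi_bound x1 (y1 + h)) as Q2.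
    apply Rabs_le_between in Q1. apply Rabs_le_between in Q2. lra. }
  apply Rabs_lt_between. apply Rle_lt_trans with (2 * M / eps); [|unfold X; lra].
  apply Rmult_le_reg_l with eps; auto.
  replace (eps * (2 * M / eps)) with (2 * M) by (field; lra).
  apply Rle_trans with (eps * p x1); [apply Rmult_le_compat_l; auto; lra|lra]. }
set (e := exp (- a * s1)).
assert (He : 0 < e) by apply exp_pos.
assert (Dp : forall x, is_derive p x (x / p x)).
{ intros x. unfold p. auto_derive; [nra|]. field. specialize (Hp1 x). unfold p in Hp1. lra. }
assert (Dpp : forall x, is_derive (fun x => x / p x) x (/ (p x * p x * p x))).
{ intros x. specialize (Hp1 x). evar_last.
  - apply (is_derive_div (fun x => x) p x 1 (x / p x)); [apply (is_derive_id x)|apply Dp|lra].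
  - specialize (Hpp x). apply Rmult_eq_reg_r with (p x * p x * p x).
    2:{ repeat apply Rmult_integral_contrapositive_currified; lra. }
    transitivity 1; [|symmetry; field; lra].
    transitivity (p x * p x - x * x); [field; lra|rewrite Hpp; ring]. }
(* [LF > 0] in the strip, while [Lw <= 0] wherever [w < 0] *)
set (F := fun x y => eta * exp (- a * (y + k * p x)) - eps * p x).
set (p1 := x1 / p x1). set (p2 := / (p x1 * p x1 * p x1)).
assert (Hp2 : 0 < p2 <= 1).
{ specialize (Hp1 x1). assert (1 <= p x1 * p x1 * p x1) by nra. unfold p2. split.
  - apply Rinv_0_lt_compat; lra.
  - rewrite <- Rinv_1. apply Rinv_le_contravar; lra. }
(* Moving in [x] at fixed [y] is slanted in the straightened coordinates: [sigma] changes by at most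
   [Rabs k * Rabs (x - x1)], hence the division by [Rabs k + 1] in the radius. *)
destruct (local_min_test (fun x => w h x y1) (fun x => F x y1)
  (fun x => phix x (y1 + h) - phix x y1)
  (fun x => (- a * k * eta * exp (- a * (y1 + k * p x)) - eps) * (x / p x))
  (phixx x1 (y1 + h) - phixx x1 y1)
  (a * a * k * k * eta * e * (p1 * p1) + (- a * k * eta * e - eps) * p2) x1
  (Rmin (Rmin (X - x1) (x1 + X)) (Rmin (l - s1) (s1 + l) / (Rabs k + 1)))) as [_ Txx].
{ pose proof (Rabs_pos k).
  apply Rmin_glb_lt; [apply Rmin_glb_lt; lra|].
  apply Rdiv_lt_0_compat; [apply Rmin_glb_lt; lra|lra]. }
{ intros x Hd.
  pose proof (Rlt_le_trans _ _ _ Hd (Rmin_l _ _)) as Hd1.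
  pose proof (Rlt_le_trans _ _ _ Hd (Rmin_r _ _)) as Hd2.
  pose proof (Rmin_l (X - x1) (x1 + X)). pose proof (Rmin_r (X - x1) (x1 + X)).
  pose proof (Rmin_l (l - s1) (s1 + l)). pose proof (Rmin_r (l - s1) (s1 + l)).
  pose proof (Rabs_pos k). pose proof (Rabs_pos (x - x1)).
  assert (Hd3 : (Rabs k + 1) * Rabs (x - x1) < Rmin (l - s1) (s1 + l)).
  { apply Rmult_lt_compat_l with (r := Rabs k + 1) in Hd2; [|lra].
    replace ((Rabs k + 1) * (Rmin (l - s1) (s1 + l) / (Rabs k + 1)))
      with (Rmin (l - s1) (s1 + l)) in Hd2 by (field; lra). exact Hd2. }
  pose proof (sigma_lipschitz x1 y1 x y1) as Hs. unfold sigma in Hs. fold (p x) (p x1) in Hs.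
  rewrite <- Hsy1 in Hs.
  replace (y1 - y1) with 0 in Hs by ring. rewrite Rabs_R0 in Hs.
  apply Rabs_le_between in Hs. apply Rabs_def2 in Hd1.
  pose proof (Hmin x (y1 + k * p x) 0 ltac:(lra) ltac:(lra) ltac:(lra)) as Hm1.
  replace (y1 + k * p x - k * p x) with y1 in Hm1 by ring.
  unfold F. rewrite <- Hsy1. lra. }
{ intros x. apply Wx. }
{ intros x. unfold F. evar_last.
  - apply (is_derive_minus (fun x => eta * exp (- a * (y1 + k * p x))) (fun x => eps * p x)).
    + apply (is_derive_scal (fun x => exp (- a * (y1 + k * p x)))).
      apply (is_derive_comp exp (fun x => - a * (y1 + k * p x))); [apply is_derive_exp|].
      apply (is_derive_scal (fun x => y1 + k * p x)).
      apply (is_derive_plus (fun _ => y1) (fun x => k * p x)); [apply is_derive_const|].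
      apply (is_derive_scal p), Dp.
    + apply (is_derive_scal p), Dp.
  - unfold scal, plus, minus, opp, zero; simpl; unfold mult; simpl. unfold plus, opp; simpl. ring. }
{ apply Wxx. }
{ evar_last.
  - apply (is_derive_mult (fun x => - a * k * eta * exp (- a * (y1 + k * p x)) - eps) (fun x => x / p x)).
    + apply (is_derive_minus (fun x => - a * k * eta * exp (- a * (y1 + k * p x))) (fun x => eps)); [|apply is_derive_const].
      apply (is_derive_scal (fun x => exp (- a * (y1 + k * p x)))).
      apply (is_derive_comp exp (fun x => - a * (y1 + k * p x))); [apply is_derive_exp|].
      apply (is_derive_scal (fun x => y1 + k * p x)).
      apply (is_derive_plus (fun _ => y1) (fun x => k * p x)); [apply is_derive_const|].
      apply (is_derive_scal p), Dp.
    + apply Dpp.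
    + intros; apply Rmult_comm.
  - rewrite <- Hsy1. fold e p1 p2.
    unfold scal, plus, minus, opp, zero; simpl; unfold mult; simpl. unfold plus, opp; simpl. ring. }
destruct (local_min_test (fun y => w h x1 y) (fun y => F x1 y)
  (fun y => phiy x1 (y + h) - phiy x1 y)
  (fun y => - a * eta * exp (- a * (y + k * p x1)))
  (phiyy x1 (y1 + h) - phiyy x1 y1)
  (a * a * eta * e) y1
  (Rmin (l - s1) (s1 + l))) as [Ty Tyy].
{ apply Rmin_glb_lt; lra. }
{ intros y Hd.
  pose proof (Rmin_l (l - s1) (s1 + l)). pose proof (Rmin_r (l - s1) (s1 + l)).
  apply Rabs_def2 in Hd.
  pose proof (Hmin x1 (y + k * p x1) 0 ltac:(lra) ltac:(lra) ltac:(lra)) as Hm1.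
  replace (y + k * p x1 - k * p x1) with y in Hm1 by ring.
  unfold F. rewrite <- Hsy1. lra. }
{ intros y. apply Wy. }
{ intros y. unfold F. auto_derive; auto. unfold Rminus. ring. }
{ apply Wyy. }
{ unfold e. rewrite Hsy1. auto_derive; auto. unfold Rminus. ring. }
rewrite <- Hsy1 in Ty. fold e in Ty.
assert (Hwneg : w h x1 y1 < 0) by lra.
(* This is [Lw <= 0] at the minimum. Since [w < 0], the smaller value is [phi x1 (y1 + h)]: either
   both values are at most [theta], or both are at least [1 - rho]. *)
assert (Hf : f (phi x1 y1) <= f (phi x1 (y1 + h))).
{ unfold w in Hwneg. destruct (Hcase x1 y1 Hwneg) as [Hc|Hc].
  - rewrite !f_low by lra. lra.
  - apply f_decr; lra. }
pose proof (pde x1 y1) as P0. pose proof (pde x1 (y1 + h)) as P1.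
assert (Hby : b x1 * (phiy x1 (y1 + h) - phiy x1 y1) = - (eta * e * a * b x1)) by (rewrite Ty; ring).
assert (Hee : 0 < eta * e * a) by (apply Rmult_lt_0_compat; [apply Rmult_lt_0_compat; auto|lra]).
assert (H1 : 0 <= a * a * k * k * eta * e * (p1 * p1)).
{ replace (a * a * k * k * eta * e * (p1 * p1)) with (eta * e * ((a * k * p1) * (a * k * p1))) by ring.
  apply Rmult_le_pos; [nra|apply Rle_0_sqr]. }
assert (Hkp : k * p2 <= Rabs k).
{ pose proof (Rle_abs k). pose proof (Rabs_pos k). nra. }
assert (Hb1 : b x1 <= B) by (eapply Rle_trans; [apply Rle_abs|apply b_bound]).
assert (H2 : eta * e * a * (a - k * p2 - b x1) >= eta * e * a).
{ apply Rle_ge. rewrite <- (Rmult_1_r (eta * e * a)) at 1. apply Rmult_le_compat_l; unfold a in *; lra. }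
assert (H3 : eps * p2 <= eps) by nra.
assert (H4 : eta * a * exp (- a * l) <= eta * e * a).
{ replace (eta * e * a) with (eta * a * e) by ring. apply Rmult_le_compat_l; [lra|].
  unfold e. apply exp_le. nra. }
assert (H5 : eta * e * a * (a - k * p2 - b x1) = a * a * eta * e - a * k * eta * e * p2 - eta * e * a * b x1) by ring.
lra.
Qed.

Lemma shift_diff_strip_positive (h s : R) : 0 < h -> (forall x y, 0 <= w h x y) ->
  exists mu, 0 < mu /\ forall x y, Rabs (sigma x y) <= s -> mu <= w h x y.
Proof.
intros Hh Hpos.
destruct (phi_low (1 / 4)) as [l1 Hl1]; [lra|].
destruct (phi_high (1 / 4)) as [l2 Hl2]; [lra|].
(* [N] steps of length [h] down or up from the strip reach values of [phi] below [1 / 4] or above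
   [3 / 4]. *)
destruct (INR_unbounded ((Rabs s + Rabs l1 + Rabs l2) / h + 1)) as [N HN].
pose proof (Rabs_pos s). pose proof (Rabs_pos l1). pose proof (Rabs_pos l2).
assert (HN1 : 1 < INR N).
{ assert (0 <= (Rabs s + Rabs l1 + Rabs l2) / h) by (apply Rdiv_le_0_compat; lra). lra. }
assert (HNh : Rabs s + Rabs l1 + Rabs l2 < INR N * h).
{ apply Rle_lt_trans with ((Rabs s + Rabs l1 + Rabs l2) / h * h); [right; field; lra|].
  apply Rmult_lt_compat_r; lra. }
destruct phi_lipschitz as [C [HC HL]].
(* If all [2 * N] increments were below [2 * nu], [phi] would rise by at most [1 / 4] along the
   segment, not by more than [1 / 2]. *)
set (nu := / (16 * INR N)).
assert (Hnu : 0 < nu) by (apply Rinv_0_lt_compat; lra).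
(* On the ball of radius [r], [w] varies by at most [nu], so a value [2 * nu] at the centre leaves
   [nu] throughout. *)
set (r := nu / (4 * C)).
assert (Hr : 0 < r) by (apply Rdiv_lt_0_compat; lra).
destruct (harnack B K r (INR N * h) Hr ltac:(nra) K_nonneg B_nonneg) as [c [Hc Hhar]].
exists (c * nu). split; [apply Rmult_lt_0_compat; auto|].
intros x y Hxy.
assert (Hj : exists j, (j < 2 * N)%nat /\ 2 * nu <= w h x (y - INR N * h + INR j * h)).
{ apply NNPP. intros Hno.
  assert (Hsum : forall n, (n <= 2 * N)%nat ->
    phi x (y - INR N * h + INR n * h) - phi x (y - INR N * h) <= INR n * (2 * nu)).
  { induction n as [|n IH]; intros Hn.
    - simpl. rewrite !Rmult_0_l, Rplus_0_r. lra.
    - rewrite S_INR.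
      assert (w h x (y - INR N * h + INR n * h) < 2 * nu).
      { apply Rnot_le_lt. intros Hle. apply Hno. exists n. split; [lia|auto]. }
      specialize (IH ltac:(lia)). unfold w in *.
      replace (y - INR N * h + (INR n + 1) * h) with (y - INR N * h + INR n * h + h) by ring. lra. }
  specialize (Hsum (2 * N)%nat (le_n _)). rewrite mult_INR in Hsum. simpl (INR 2) in Hsum.
  replace ((1 + 1) * INR N * (2 * nu)) with (1 / 4) in Hsum by (unfold nu; field; lra).
  apply Rabs_le_between in Hxy.
  pose proof (Rle_abs s). pose proof (Rle_abs l2). pose proof (Rle_abs (- l1)) as Hn. rewrite Rabs_Ropp in Hn.
  pose proof (Hl1 x (y - INR N * h)) as Q1. pose proof (Hl2 x (y - INR N * h + (1 + 1) * INR N * h)) as Q2.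
  unfold sigma in *. specialize (Q1 ltac:(lra)). specialize (Q2 ltac:(lra)). lra. }
destruct Hj as [j [Hj Hw]].
apply (Hhar _ _ _ _ _ b x (y - INR N * h + INR j * h) nu (axis_C2_shift_diff _ _ _ _ _ h phi_C2)); auto.
(* [w >= 0] turns the Lipschitz bound on [f] into [Lw <= K * w]. *)
- intros x' y'. pose proof (pde x' y'). pose proof (pde x' (y' + h)).
  pose proof (f_lip (phi x' y') (phi x' (y' + h))) as Hf. specialize (Hpos x' y'). unfold w in Hpos.
  rewrite (Rabs_left1 (phi x' y' - phi x' (y' + h))) in Hf by lra.
  replace (- (phi x' y' - phi x' (y' + h))) with (phi x' (y' + h) - phi x' y') in Hf by ring.
  apply Rabs_le_between in Hf. lra.
- intros x' y' Hd.
  assert (Hsq : forall z v, z ^ 2 + v ^ 2 <= r ^ 2 -> Rabs z <= r).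
  { intros z v Hzv. apply Rabs_le. assert (0 <= v ^ 2) by apply pow2_ge_0.
    split; apply Rnot_lt_le; intros Hlt; assert (r * r < z * z) by nra; lra. }
  pose proof (Hsq _ _ Hd) as D1. rewrite Rplus_comm in Hd. pose proof (Hsq _ _ Hd) as D2.
  set (yj := y - INR N * h + INR j * h) in *.
  pose proof (HL x' y' x yj) as L1. pose proof (HL x' (y' + h) x (yj + h)) as L2.
  replace (y' + h - (yj + h)) with (y' - yj) in L2 by ring.
  assert (HCr : C * (Rabs (x' - x) + Rabs (y' - yj)) <= nu / 2).
  { replace (nu / 2) with (C * (r + r)) by (unfold r; field; lra). apply Rmult_le_compat_l; lra. }
  apply Rabs_le_between in L1. apply Rabs_le_between in L2. unfold w in Hw. lra.
- replace (x - x) with 0 by ring.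
  replace (y - (y - INR N * h + INR j * h)) with ((INR N - INR j) * h) by ring.
  pose proof (pos_INR j). assert (Hj2 : INR j <= 2 * INR N).
  { change 2 with (INR 2). rewrite <- mult_INR. apply le_INR. lia. }
  assert ((INR N - INR j) ^ 2 <= INR N ^ 2) by nra.
  rewrite !Rpow_mult_distr. assert (0 <= h ^ 2) by apply pow2_ge_0. nra.
Qed.

(** Let [hs] be the supremum of the shifts for which [w] is negative somewhere. Continuity makes
    [hs] itself a good shift; its positive lower bound on the strip then survives for slightly
    smaller shifts, and comparison makes these good too, contradicting the choice of [hs]. *)
Lemma shift_diff_nonneg (h : R) : 0 < h -> forall x y, 0 <= w h x y.
Proof.
intros Hh.
destruct (phi_low theta theta_pos) as [l1 Hl1].
destruct (phi_high rho rho_pos) as [l2 Hl2].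
set (s := Rabs l1 + Rabs l2 + 1).
pose proof (Rabs_pos l1) as A1. pose proof (Rabs_pos l2) as A2.
pose proof (Rle_abs l2) as A3. pose proof (Rle_abs (- l1)) as A4. rewrite Rabs_Ropp in A4.
assert (Hout : forall h' x y, 0 < h' -> s <= Rabs (sigma x y) ->
  phi x y <= theta \/ 1 - rho <= phi x (y + h')).
{ intros h' x y Hh' Hs. destruct (Rle_lt_dec 0 (sigma x y)) as [Hp|Hp].
  - right. rewrite Rabs_pos_eq in Hs by auto. left. apply Hl2.
    unfold sigma in *. unfold s in Hs. lra.
  - left. rewrite Rabs_left in Hs by auto. left. apply Hl1. unfold s in Hs. lra. }
(* From a point with [Rabs (sigma x y) < s], a shift by [2 * s] lands above [l2]. *)
assert (Hlarge : forall h', 2 * s <= h' -> forall x y, 0 <= w h' x y).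
{ intros h' Hh'. apply shift_diff_comparison; [unfold s in *; lra|].
  intros x y _. destruct (Rle_lt_dec s (Rabs (sigma x y))) as [Hle|Hlt].
  - apply Hout; auto. unfold s in *; lra.
  - right. left. apply Hl2. apply Rabs_def2 in Hlt. unfold sigma, s in *. lra. }
apply NNPP. intros Hbad.
set (E := fun h' => 0 < h' /\ ~ (forall x y, 0 <= w h' x y)).
destruct (completeness E) as [hs [Hub Hlub]].
{ exists (2 * s). intros h' [_ Hn]. apply Rnot_lt_le. intros Hlt. apply Hn, Hlarge. lra. }
{ exists h. split; auto. }
assert (Hhs : 0 < hs) by (apply Rlt_le_trans with h; auto; apply Hub; split; auto).
destruct phi_lipschitz as [C [HC HL]].
assert (HLw : forall h1 h2 x y, Rabs (w h1 x y - w h2 x y) <= C * Rabs (h1 - h2)).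
{ intros h1 h2 x y. unfold w.
  replace (phi x (y + h1) - phi x y - (phi x (y + h2) - phi x y))
    with (phi x (y + h1) - phi x (y + h2)) by ring.
  eapply Rle_trans; [apply HL|]. right. replace (x - x) with 0 by ring. rewrite Rabs_R0, Rplus_0_l.
  do 2 f_equal. ring. }
assert (Hw : forall x y, 0 <= w hs x y).
{ intros x y. apply Rnot_lt_le. intros Hlt.
  (* A good shift just above [hs], so close that a negative [w hs x y] could at most be halved. *)
  set (h' := hs + - w hs x y / (2 * C)).
  assert (Hd : 0 < - w hs x y / (2 * C)) by (apply Rdiv_lt_0_compat; lra).
  assert (Hh' : 0 <= w h' x y).
  { assert (~ E h') as Hn by (intros HE; apply Hub in HE; unfold h' in HE; lra).
    apply NNPP. intros Hn2. apply Hn. split; [unfold h'; lra|auto]. }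
  pose proof (HLw h' hs x y) as Hl. unfold h' in Hl at 2.
  replace (hs + - w hs x y / (2 * C) - hs) with (- w hs x y / (2 * C)) in Hl by ring.
  rewrite (Rabs_pos_eq (_ / _)) in Hl by lra.
  replace (C * (- w hs x y / (2 * C))) with (- w hs x y / 2) in Hl by (field; lra).
  apply Rabs_le_between in Hl. lra. }
destruct (shift_diff_strip_positive hs s Hhs Hw) as [mu [Hmu Hstrip]].
set (d := Rmin (mu / C) (hs / 2)).
assert (Hd : 0 < d) by (apply Rmin_glb_lt; [apply Rdiv_lt_0_compat; auto|lra]).
assert (Hd1 : C * d <= mu).
{ replace mu with (C * (mu / C)) by (field; lra). apply Rmult_le_compat_l; [lra|apply Rmin_l]. }
assert (Hd2 : d <= hs / 2) by apply Rmin_r.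
assert (hs <= hs - d); [|lra].
apply Hlub. intros h' [Hh'0 Hn]. apply Rnot_lt_le. intros Hlt. apply Hn.
assert (Hle : h' <= hs) by (apply Hub; split; auto).
apply shift_diff_comparison; auto.
intros x y Hneg. destruct (Rle_lt_dec s (Rabs (sigma x y))) as [Hs|Hs].
- apply Hout; auto.
- exfalso. specialize (Hstrip x y ltac:(lra)). pose proof (HLw h' hs x y) as Hl.
  rewrite (Rabs_left1 (h' - hs)) in Hl by lra. apply Rabs_le_between in Hl.
  assert (C * - (h' - hs) <= C * d) by (apply Rmult_le_compat_l; lra). lra.
Qed.

Lemma sliding_strict (x y h : R) : 0 < h -> phi x y < phi x (y + h).
Proof.
intros Hh.
(* The half-width [Rabs (sigma x y)] makes the strip contain the given point. *)
destruct (shift_diff_strip_positive h (Rabs (sigma x y)) Hh (shift_diff_nonneg h Hh)) as [mu [Hmu Hs]].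
specialize (Hs x y (Rle_refl _)). unfold w in Hs. lra.
Qed.

End Sliding.

(** * From the standing assumptions to the sliding hypotheses *)

Lemma periodic_bounded (q : R -> R) (L : R) :
  continuity q -> 0 < L -> (forall x, q (x + L) = q x) ->
  exists Q, forall x, Rabs (q x) <= Q.
Proof.
intros Hc HL Hper.
destruct (continuity_ab_maj q 0 L) as [xM [HM _]]; [lra|auto|].
destruct (continuity_ab_min q 0 L) as [xm [Hm _]]; [lra|auto|].
assert (Hn : forall (n : nat) x, q (x + INR n * L) = q x).
{ induction n as [|n IH]; intros x; [simpl; f_equal; ring|].
  rewrite S_INR. replace (x + (INR n + 1) * L) with ((x + INR n * L) + L) by ring.
  rewrite Hper. apply IH. }
assert (Hbase : forall x, exists y, 0 <= y <= L /\ q x = q y).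
{ intros x. pose proof (base_Int_part (x / L)) as [H1 H2].
  set (z := Int_part (x / L)) in *.
  exists (x - IZR z * L). split.
  - assert (Hx : x / L * L = x) by (field; lra).
    assert (IZR z * L <= x / L * L) by (apply Rmult_le_compat_r; lra).
    assert ((x / L - IZR z) * L <= 1 * L) by (apply Rmult_le_compat_r; lra). lra.
  - destruct (Z.le_gt_cases 0 z) as [Hz|Hz].
    + rewrite <- (Hn (Z.to_nat z) (x - IZR z * L)). rewrite INR_IZR_INZ, Z2Nat.id by lia.
      f_equal. ring.
    + rewrite <- (Hn (Z.to_nat (- z)) x). rewrite INR_IZR_INZ, Z2Nat.id by lia.
      rewrite opp_IZR. f_equal. ring. }
exists (Rabs (q xM) + Rabs (q xm)). intros x.
destruct (Hbase x) as [y [Hy ->]]. specialize (HM y Hy). specialize (Hm y Hy).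
pose proof (Rle_abs (q xM)). pose proof (Rle_abs (- q xm)) as Hr. rewrite Rabs_Ropp in Hr.
pose proof (Rabs_pos (q xM)). pose proof (Rabs_pos (q xm)). apply Rabs_le. lra.
Qed.

(** Vanishing at both endpoints makes [f] equal to [f] composed with clipping to [[0, 1]], which is
    1-Lipschitz. [Rabs K] is taken because the sign of [K] is not given. *)
Lemma lipschitz_extend_by_zero (f : R -> R) (K : R) :
  (forall u, u < 0 \/ 1 < u -> f u = 0) -> f 0 = 0 -> f 1 = 0 ->
  (forall a b, 0 <= a <= 1 -> 0 <= b <= 1 -> Rabs (f a - f b) <= K * Rabs (a - b)) ->
  forall a b, Rabs (f a - f b) <= Rabs K * Rabs (a - b).
Proof.
intros Hout H0 H1 HK.
assert (Hclip : forall a, exists a', 0 <= a' <= 1 /\ f a = f a' /\ a' = Rmax 0 (Rmin 1 a)).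
{ intros a. exists (Rmax 0 (Rmin 1 a)). unfold Rmax, Rmin.
  destruct (Rle_dec 1 a); destruct (Rle_dec 0 _); split; try lra; split; auto.
  - destruct (Req_dec 1 a) as [<-|]; auto. rewrite Hout, H1; auto. right; lra.
  - rewrite Hout, H0; auto. left; lra. }
intros a b. destruct (Hclip a) as (a' & Ha & -> & Ea). destruct (Hclip b) as (b' & Hb & -> & Eb).
eapply Rle_trans; [apply HK; auto|].
apply Rle_trans with (Rabs K * Rabs (a' - b')).
- apply Rmult_le_compat_r; [apply Rabs_pos|apply Rle_abs].
- apply Rmult_le_compat_l; [apply Rabs_pos|]. rewrite Ea, Eb.
  unfold Rmax, Rmin, Rabs. repeat destruct (Rle_dec _ _); repeat destruct (Rcase_abs _); lra.
Qed.

(** For [v < 1] the mean value theorem applies with [f'] negative near [1]; for [v >= 1] it is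
    enough that [f v = 0 <= f u]. Differentiability across [1] is thus avoided. *)
Lemma decreasing_near_one (f f' : R -> R) (r : R) :
  (forall u, 0 <= f u) -> (forall u, 1 <= u -> f u = 0) -> 0 < r ->
  (forall u, 1 - r < u < 1 -> derivable_pt_lim f u (f' u)) ->
  (forall eps, 0 < eps -> exists d, 0 < d /\
     forall v, 1 - r < v <= 1 -> Rabs (v - 1) < d -> Rabs (f' v - f' 1) < eps) ->
  f' 1 < 0 ->
  exists rho, 0 < rho /\ forall u v, 1 - rho <= u -> u <= v -> f v <= f u.
Proof.
intros Hpos Hone Hr Hder Hcont Hneg.
destruct (Hcont (- f' 1)) as [d [Hd Hd1]]; [lra|].
set (rho := Rmin (r / 2) (d / 2)).
assert (Hrho : 0 < rho /\ rho < r /\ rho < d).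
{ unfold rho. pose proof (Rmin_l (r / 2) (d / 2)). pose proof (Rmin_r (r / 2) (d / 2)).
  split; [apply Rmin_glb_lt; lra|lra]. }
exists rho. split; [lra|]. intros u v Hu Huv.
destruct (Rle_lt_dec 1 v) as [Hv|Hv]; [rewrite Hone; auto|].
destruct (Req_dec u v) as [->|Hne]; [lra|].
destruct (MVT_cor2 f f' u v) as [xi [Heq Hxi]]; [lra|intros z Hz; apply Hder; lra|].
assert (f' xi < 0).
{ specialize (Hd1 xi ltac:(lra)). rewrite Rabs_left in Hd1 by lra. specialize (Hd1 ltac:(lra)).
  apply Rabs_def2 in Hd1. lra. }
nra.
Qed.

Lemma axis_C2_of_C2_with (phi phix phiy phixx phixy phiyx phiyy : R -> R -> R) :
  C2_with phi phix phiy phixx phixy phiyx phiyy -> axis_C2 phi phix phiy phixx phiyy.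
Proof.
intros (Hc & _ & _ & _ & _ & _ & _ & Hx & Hy & Hxx & _ & _ & Hyy).
split; [|split; [|split; [|split]]].
- intros [x y]. apply (proj2 (filterlim_locally _ _)). intros eps.
  destruct (Hc x y eps (cond_pos eps)) as [d [Hd H]].
  exists (mkposreal d Hd). intros [x' y'] [H1 H2]. apply H; assumption.
- intros x y. apply is_derive_Reals, Hx.
- intros x y. apply is_derive_Reals, Hy.
- intros x y. apply is_derive_Reals, Hxx.
- intros x y. apply is_derive_Reals, Hyy.
Qed.

Lemma cone_minus_abs (alpha l x y : R) :
  cone_minus alpha l x y <-> y + cot alpha * Rabs x <= l.
Proof.
unfold cone_minus. split.
- intros [H1 H2]. destruct (Rle_dec 0 x).
  + rewrite Rabs_pos_eq by lra. specialize (H2 ltac:(lra)). lra.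
  + rewrite Rabs_left by lra. specialize (H1 ltac:(lra)). lra.
- intros H. split; intros Hx.
  + rewrite Rabs_left1 in H by lra. lra.
  + rewrite Rabs_pos_eq in H by lra. lra.
Qed.

(** The smooth coordinate [sigma] stays within [Rabs k] of the cone coordinate, so limits over cones
    become limits in [sigma] after a shift of the level. *)
Lemma abs_sqrt_1_sqr (k x : R) :
  Rabs (k * sqrt (1 + x * x) - k * Rabs x) <= Rabs k.
Proof.
rewrite <- Rmult_minus_distr_l, Rabs_mult. rewrite <- (Rmult_1_r (Rabs k)) at 2.
apply Rmult_le_compat_l; [apply Rabs_pos|].
pose proof (Rabs_pos x) as Hx.
assert (Hxx : x * x = Rabs x * Rabs x) by (rewrite <- Rabs_mult, Rabs_pos_eq; [ring|apply Rle_0_sqr]).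
rewrite Hxx.
assert (H1 : Rabs x <= sqrt (1 + Rabs x * Rabs x)).
{ rewrite <- (sqrt_square (Rabs x)) at 1 by auto. apply sqrt_le_1_alt. lra. }
assert (H2 : sqrt (1 + Rabs x * Rabs x) <= Rabs x + 1).
{ rewrite <- (sqrt_square (Rabs x + 1)) by lra. apply sqrt_le_1_alt. nra. }
apply Rabs_le. lra.
Qed.

Theorem theorem2
  (q f : R -> R) (alpha c : R)
  (phi phix phiy phixx phixy phiyx phiyy : R -> R -> R) :
  q_assumptions q ->
  f_assumptions f ->
  0 < alpha < PI ->
  C2_with phi phix phiy phixx phixy phiyx phiyy ->
  (exists M, forall x y, Rabs (phi x y) <= M) ->
  (forall x y, phixx x y + phiyy x y + (q x - c) * phiy x y + f (phi x y) = 0) ->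
  (forall eps, 0 < eps -> exists L, forall l, l <= L ->
     exists s, is_lub (values_on phi (cone_minus alpha l)) s /\ Rabs s < eps) ->
  (forall eps, 0 < eps -> exists L, forall l, L <= l ->
     exists s, is_glb (values_on phi (cone_plus alpha l)) s /\ Rabs (s - 1) < eps) ->
  forall x y h, 0 < h -> phi x y < phi x (y + h).
Proof.
intros Hq Hf _ Hphi [M HM] Hpde Hlow Hupp x y h Hh.
destruct Hq as [[delta [_ [q' [Hq' _]]]] [L [HL [Hper _]]]].
destruct (periodic_bounded q L) as [Q HQ]; auto.
{ intros z. apply derivable_continuous_pt. exists (q' z). apply Hq'. }
destruct Hf as (Hout & [K HK] & (r & Hr & f' & Hder & _ & Hcont & Hneg) & theta & Hth & Hzero & Hone & Hpos).
assert (f_high : forall u, 1 <= u -> f u = 0).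
{ intros u Hu. destruct (Req_dec u 1) as [->|]; auto. apply Hout. right; lra. }
assert (f_low : forall u, u <= theta -> f u = 0).
{ intros u Hu. destruct (Rle_lt_dec 0 u); [apply Hzero; lra|apply Hout; lra]. }
assert (f_nonneg : forall u, 0 <= f u).
{ intros u. destruct (Rle_lt_dec u theta) as [H|H]; [rewrite f_low; auto; lra|].
  destruct (Rle_lt_dec 1 u) as [H1|H1]; [rewrite f_high; auto; lra|].
  left. apply Hpos. lra. }
destruct (decreasing_near_one f f' r) as [rho [Hrho Hdec]]; auto.
{ apply (Hcont 1). lra. }
apply (sliding_strict phi phix phiy phixx phiyy (fun x => q x - c) f (Q + Rabs c) M (Rabs K)
  (cot alpha) theta rho); auto; try lra.
- eapply axis_C2_of_C2_with; eauto.
- intros z. unfold Rminus. eapply Rle_trans; [apply Rabs_triang|]. rewrite Rabs_Ropp.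
  apply Rplus_le_compat_r, HQ.
- apply lipschitz_extend_by_zero; auto. apply f_low. lra.
- intros eps Heps. destruct (Hlow eps Heps) as [l Hl].
  exists (l - Rabs (cot alpha)). intros x' y' Hxy.
  destruct (Hl l (Rle_refl l)) as [s [[Hub _] Hs]].
  apply Rle_lt_trans with s; [|apply Rabs_def2 in Hs; lra].
  apply Hub. exists x', y'. split; [|reflexivity].
  apply cone_minus_abs. pose proof (abs_sqrt_1_sqr (cot alpha) x') as Hk.
  apply Rabs_le_between in Hk. lra.
- intros eps Heps. destruct (Hupp eps Heps) as [l Hl].
  (* The [+ 1] places the point strictly outside the lower cone; it then lies in the closure of the
     complement as its own approximation. *)
  exists (l + Rabs (cot alpha) + 1). intros x' y' Hxy.
  destruct (Hl l (Rle_refl l)) as [s [[Hlb _] Hs]].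
  apply Rlt_le_trans with s; [apply Rabs_def2 in Hs; lra|].
  apply Hlb. exists x', y'. split; [|reflexivity].
  intros e He. exists x', y'. split.
  + rewrite cone_minus_abs. pose proof (abs_sqrt_1_sqr (cot alpha) x') as Hk.
    apply Rabs_le_between in Hk. lra.
  + replace ((x' - x') ^ 2 + (y' - y') ^ 2) with 0 by ring. rewrite sqrt_0. auto.
Qed.
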